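(* Let $n$ and $r$ be positive integers and let $G$ be one of the Higman-Thompson groups $F_{n,r}$, $G_{n,r}$. Then the Koopman representation of $G$ on $L^2([0,r],\lambda_r)$ corresponding to the canonical action of $G$ on $([0,r],\lambda_r)$ is irreducible.
   Context: Let $\mathbb Z[1/n]=\{p/n^k : p\in\mathbb Z,\ k\in\mathbb Z,\ k\geqslant 0\}$. The group $F_{n,r}$ consists of all orientation preserving piecewise linear homeomorphisms $h$ of $[0,r]$ (finitely many pieces) such that all singularities of $h$ (points of non-differentiability) are in $\mathbb Z[1/n]$ and the derivative of $h$ at any non-singular point is $n^k$ for some $k\in\mathbb Z$ (depending on the point). The group $G_{n,r}$ is the group of all right continuous piecewise linear bijections $h$ of $[0,r)$ with finitely many discontinuities and singularities, all in $\mathbb Z[1/n]$, such that the derivative of $h$ at any non-singular point is $n^k$ for some $k\in\mathbb Z$ and $h$ maps $\mathbb Z[1/n]\cap[0,r)$ to itself. $\lambda_r$ is the Lebesgue probability measure on $[0,r]$, i.e. Lebesgue measure divided by $r$. The canonical action is the tautological action by evaluation; elements of $G_{n,r}$ are regarded as acting on $[0,r]$ by fixing the point $r$ (a null set). The measure $\lambda_r$ is quasi-invariant under this action. For a group $G$ acting on a probability space $(X,\mu)$ by measurable transformations with $\mu$ quasi-invariant, the Koopman representation $\kappa$ of $G$ is the unitary representation in the complex Hilbert space $L^2(X,\mu)$ given by $$(\kappa(g)f)(x)=\sqrt{\frac{d\mu(g^{-1}(x))}{d\mu(x)}}\,f(g^{-1}x),$$ where $\frac{d\mu(g^{-1}(x))}{d\mu(x)}$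 denotes the Radon-Nikodym derivative with respect to $\mu$ of the measure $B\mapsto\mu(g^{-1}B)$. Irreducible means that the only closed $\kappa(G)$-invariant subspaces are $\{0\}$ and the whole space.
   Formalization: The formal theorem assumes n ≥ 2: for n = 1 the group F_{1,r} is trivial and G_{1,r} is the finite group permuting the r unit intervals, so the Koopman representation on the infinite-dimensional L^2([0,r]) is reducible. *)

(* Defs.v *)
Set Warnings "-notation-overridden,-notation-incompatible-prefix".
From HB Require Import structures.
From mathcomp Require Import all_boot all_order all_algebra.
From mathcomp Require Import complex.
From mathcomp Require Import all_classical all_reals all_analysis.
From mathcomp Require Import measurable_realfun ring lra.

Set Implicit Arguments.
Unset Strict Implicit.
Unset Printing Implicit Defensive.

Import Order.TTheory GRing.Theory Num.Theory.
Import numFieldNormedType.Exports.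

Local Open Scope classical_set_scope.
Local Open Scope ring_scope.
Local Open Scope complex_scope.

Section koopman_representation.
Context d (T : measurableType d) (R : realType) (mu : probability T R).

(* Invertible bi-measurable transformations with respect to which [mu] is
   quasi-invariant; [distribution mu g] is the measure B |-> mu (g^-1 B). *)
Record nonsingular := Nonsingular {
  ns_fun : {mfun T >-> T} ;
  ns_inv : {mfun T >-> T} ;
  ns_funK : cancel ns_fun ns_inv ;
  ns_invK : cancel ns_inv ns_fun ;
  ns_dominates : distribution mu ns_fun `<< mu ;
  ns_dominated : mu `<< distribution mu ns_fun }.

Definition transported_density (g : nonsingular) : T -> R :=
  fun x => fine (Radon_Nikodym
    (charge_of_finite_measure (distribution mu (ns_fun g))) mu x).

Definition koopman (g : nonsingular) (f : T -> R[i]) : T -> R[i] :=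
  fun x => (Num.sqrt (transported_density g x))%:C * f (ns_inv g x).

Definition L2norm (f : T -> R[i]) : \bar R :=
  Lnorm mu 2%:E (fun x => (ComplexField.Normc.normc (f x))%:E).

(* Square-integrable complex functions. Elements of the Hilbert space are the
   classes of such functions modulo a.e. equality; as usual they are handled
   through representatives. *)
Definition L2 : set (T -> R[i]) := [set f |
  [/\ measurable_fun [set: T] (fun x => complex.Re (f x)),
      measurable_fun [set: T] (fun x => complex.Im (f x)) &
      (L2norm f < +oo)%E]].

(* [csub_closed] makes V stable under a.e. equality (take g with
   L2norm (f - g) = 0), so that these sets are exactly the preimages of the
   closed subspaces of the Hilbert space of classes. *)
Record closed_subspace (V : set (T -> R[i])) : Prop := ClosedSubspace {
  csub_L2 : V `<=` L2 ;
  csub_0 : V (fun=> 0) ;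
  csub_linear : forall (a : R[i]) (f g : T -> R[i]),
    V f -> V g -> V (fun x => a * f x + g x) ;
  csub_closed : forall f, L2 f ->
    (forall e : R, 0 < e ->
       exists2 g, V g & (L2norm (fun x => (f x - g x)%R) < e%:E)%E) ->
    V f }.

Definition koopman_invariant (G : set nonsingular) (V : set (T -> R[i])) :=
  forall g, G g -> forall f, V f -> V (koopman g f).

Definition koopman_irreducible (G : set nonsingular) :=
  forall V, closed_subspace V -> koopman_invariant G V ->
    V = [set f | L2 f /\ f = (fun=> 0) %[ae mu]] \/ V = L2.

End koopman_representation.

Section higman_thompson.
Context (R : realType).

Definition Zinv (n : nat) : set R :=
  [set x | exists (p : int) (k : nat), x = p%:~R / n%:R ^+ k].

(* Affine with finitely many pieces on [0, r]; s lists the breakpoints. The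
   values at the breakpoints are unconstrained. *)
Definition piecewise_linear (r : nat) (h : R -> R) :=
  exists s : seq R, forall a b : R, 0 <= a -> a < b -> b <= r%:R ->
    {in s, forall x, x \notin `]a, b[} ->
    exists c e : R, {in `]a, b[, forall x, h x = c * x + e}.

(* A discontinuity is in particular a point of non-differentiability. The
   endpoints 0 and r belong to Z[1/n] anyway. *)
Definition adic_singularities (n r : nat) (h : R -> R) :=
  {in `]0, r%:R[, forall x, ~ derivable h x 1 -> Zinv n x}.

Definition adic_slopes (n r : nat) (h : R -> R) :=
  {in `]0, r%:R[, forall x, derivable h x 1 ->
    exists k : int, derive1 h x = n%:R ^ k}.

(* Self-maps of [0, r] and of [0, r) are represented by their extensions to
   the real line by the identity. *)
Definition in_F (n r : nat) (h : R -> R) :=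
  let I := `[0 : R, r%:R] in
  [/\ {in [predC I], forall x, h x = x},
      (exists h' : R -> R,
        [/\ {homo h : x / x \in I}, {homo h' : x / x \in I},
            {in I, cancel h h'}, {in I, cancel h' h} &
            {within [set` I], continuous h} /\
            {within [set` I], continuous h'}]),
      {in I &, {homo h : x y / x < y}},
      piecewise_linear r h &
      adic_singularities n r h /\ adic_slopes n r h].

Definition in_G (n r : nat) (h : R -> R) :=
  let I := (`[0 : R, r%:R[)%R in
  [/\ {in [predC I], forall x, h x = x},
      set_bij [set` I] [set` I] h,
      {in I, forall x, h y @[y --> x^'+] --> h x},
      piecewise_linear r h &
      adic_singularities n r h /\ adic_slopes n r h /\
      {in I, forall x, Zinv n x -> Zinv n (h x)}].

Lemma natr_gt0 (r : nat) : (0 < r)%N -> 0 < r%:R :> R.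
Proof. by rewrite ltr0n. Qed.

(* A probability on the real line concentrated on [0, r]. *)
Definition lambda (r : nat) (r_gt0 : (0 < r)%N) :
  probability (measurableTypeR R) R := uniform_prob (natr_gt0 r_gt0).

Definition thompson_F (n r : nat) (r_gt0 : (0 < r)%N) :
  set (nonsingular (lambda r_gt0)) :=
  [set g : nonsingular (lambda r_gt0) | in_F n r (ns_fun g)].

Definition thompson_G (n r : nat) (r_gt0 : (0 < r)%N) :
  set (nonsingular (lambda r_gt0)) :=
  [set g : nonsingular (lambda r_gt0) | in_G n r (ns_fun g)].

End higman_thompson.

Section nonsingularity.
Context (R : realType).
Local Notation leb := (@lebesgue_measure R).
Local Notation Rm := (measurableTypeR R).

Let aff (c e : R) : Rm -> Rm := fun x => c * x + e.

Let measurable_aff c e : measurable_fun setT (aff c e).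
Proof.
rewrite /aff; apply: (@measurable_realfun.measurable_funD _ _ R _ ( *%R c) (cst e)) => //.
Qed.

Let leb_aff_gt0 c e (A : set Rm) : 0 < c -> measurable A ->
  leb A = (c%:E * leb (aff c e @^-1` A))%E.
Proof.
move=> c0 mA.
pose c' : {nonneg R} := NngNum (ltW c0).
pose pf := measure_function_pushforward__canonical__measure_function_Measure
  leb (measurable_aff c e).
rewrite -[RHS]/(mscale c' pf A).
apply: lebesgue_measure_unique => // _ [[a b]] _ <-.
rewrite /mscale /= /pushforward.
have E : aff c e @^-1` (`]a, b]%classic : set R) = (`](a - e) / c, (b - e) / c]%classic : set R).
  apply/seteqP; split => x; rewrite /= !in_itv /= /aff;
    by rewrite ltr_pdivrMr// ler_pdivlMr// ltrBlDr lerBrDr mulrC.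
transitivity (c%:E * leb (`]((a - e) / c)%R, ((b - e) / c)%R]%classic : set R))%E; last first.
  by congr (_ * leb _)%E.
rewrite !lebesgue_measure_itv /= !lte_fin ltr_pM2r ?invr_gt0// ltrD2r.
case: ifP => ab; last by rewrite mule0.
by rewrite -!EFinD -EFinM; congr EFin; field; rewrite gt_eqF.
Qed.


Let leb_aff_null c e (A : set Rm) : c != 0 -> measurable A ->
  leb A = 0%E -> leb (aff c e @^-1` A) = 0%E.
Proof.
have pos c' (B : set Rm) : 0 < c' -> measurable B -> leb B = 0%E ->
    leb (aff c' e @^-1` B) = 0%E.
  move=> c0 mB B0; have := leb_aff_gt0 e c0 mB; rewrite B0 => /esym/eqP.
  by rewrite mule_eq0 eqe gt_eqF//= => /eqP.
move=> c0 mA A0; have [cn|cp|c00] := ltgtP c 0; last 2 first.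
- exact: pos.
- by rewrite c00 eqxx in c0.
have mA' : measurable (aff (- c) e @^-1` A).
  by rewrite -[X in measurable X]setTI; exact: measurable_aff.
have -> : aff c e @^-1` A = -%R @^-1` (aff (- c) e @^-1` A).
  by apply/seteqP; split => x; rewrite /= /aff mulrNN.
rewrite -[LHS]/(pushforward leb (-%R : Rm -> Rm) (aff (- c) e @^-1` A)).
by rewrite lebesgue_measureN// pos// oppr_gt0.
Qed.

(* Affine with nonzero slope on each of countably many measurable sets whose
   union has countable complement; unlike finite piecewise affineness on
   intervals, this is visibly stable under inverses. *)
Let ctbl_affine (h : Rm -> Rm) := exists (D : nat -> set Rm) (c e : nat -> R),
  [/\ forall i, measurable (D i), forall i, c i != 0,
    forall i x, D i x -> h x = aff (c i) (e i) x &
    countable (~` \bigcup_i D i)].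

Let preimageE (D : nat -> set Rm) c e h (B : set Rm) :
  (forall i x, D i x -> h x = aff (c i) (e i) x) ->
  h @^-1` B = (\bigcup_i (D i `&` aff (c i) (e i) @^-1` B)) `|`
             (h @^-1` B `\` \bigcup_i D i).
Proof.
move=> hD; apply/seteqP; split => x.
  move=> Bhx; have [[i _ Dix]|nDx] := pselect ((\bigcup_i D i) x).
    by left; exists i => //; split => //=; rewrite -hD.
  by right; split.
by case=> [[i _ [Dix]] /=|[]//]; rewrite -hD.
Qed.

Let ctbl_affine_measurable h : ctbl_affine h -> measurable_fun setT h.
Proof.
move=> [D [c [e [mD c0 hD cD]]]] _ B mB; rewrite setTI (preimageE B hD).
apply: measurableU.
  apply: bigcup_measurable => i _; apply: measurableI => //.
  by rewrite -[X in measurable X]setTI; exact: measurable_aff.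
apply: countable_measurable => //; apply: sub_countable cD.
by apply: subset_card_le => x [].
Qed.

Let ctbl_affine_null h (B : set Rm) : ctbl_affine h -> measurable B ->
  leb B = 0%E -> leb (h @^-1` B) = 0%E.
Proof.
move=> ch mB B0; apply: measure_negligible.
  by rewrite -[X in measurable X]setTI; exact: ctbl_affine_measurable.
case: ch => [D [c [e [mD c0 hD cD]]]]; rewrite (preimageE B hD).
apply: negligibleU.
  apply: negligible_bigcup => i.
  apply: (@negligibleS _ _ _ _ (aff (c i) (e i) @^-1` B)); first by move=> x [].
  apply/negligibleP; first by rewrite -[X in measurable X]setTI; exact: measurable_aff.
  exact: leb_aff_null.
have cB : countable (h @^-1` B `\` \bigcup_i D i).
  by apply: sub_countable cD; apply: subset_card_le => x [].
apply/negligibleP; first exact: countable_measurable.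
exact: countable_lebesgue_measure0.
Qed.

Let ctbl_affine_inv (h h' : Rm -> Rm) : cancel h h' -> cancel h' h ->
  ctbl_affine h -> ctbl_affine h'.
Proof.
move=> hK h'K [D [c [e [mD c0 hD cD]]]].
have affK i : cancel (aff (c i) (e i)) (aff (c i)^-1 (- e i / c i)).
  by move=> x; rewrite /aff; field; exact: c0.
have affK' i : cancel (aff (c i)^-1 (- e i / c i)) (aff (c i) (e i)).
  by move=> x; rewrite /aff; field; exact: c0.
exists (fun i => aff (c i)^-1 (- e i / c i) @^-1` D i),
  (fun i => (c i)^-1), (fun i => - e i / c i); split.
- by move=> i; rewrite -[X in measurable X]setTI; exact: measurable_aff.
- by move=> i; rewrite invr_eq0.
- by move=> i x /= Dx; rewrite -[RHS]hK (hD i _ Dx) affK'.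
- apply: (@sub_countable _ _ _ (h @` (~` \bigcup_i D i))); last first.
    exact: sub_countable (card_image_le _ _) cD.
  apply: subset_card_le => x nx; exists (h' x) => //= -[i _ Dx]; apply: nx.
  by exists i => //=; rewrite -[X in aff _ _ X](h'K x) (hD i _ Dx) affK.
Qed.

Let ctbl_affine_pl r (h : Rm -> Rm) : injective h -> piecewise_linear r h ->
  {in [predC `[0, r%:R]], forall x, h x = x} -> ctbl_affine h.
Proof.
move=> hI [s hs] hid.
pose aff_on (D : set R) (c e : R) :=
  c != 0 /\ forall x, D x -> h x = aff c e x.
have loc (x : R) : x \notin [:: 0, r%:R & s] ->
    exists2 eps, 0 < eps & exists c e, aff_on `]x - eps, x + eps[%classic c e.
  move=> xs.
  have [eps eps0 epsP] : exists2 eps : R, 0 < eps &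
      {in [:: 0, r%:R & s], forall y, y \notin `]x - eps, x + eps[}.
    elim: [:: 0, r%:R & s] xs => [|y t IH]; first by exists 1.
    rewrite in_cons negb_or => /andP[xy /IH[eps eps0 epsP]].
    exists (Num.min eps `|x - y|).
      by rewrite lt_min eps0 normr_gt0 subr_eq0.
    move=> z; rewrite in_cons => /predU1P[->|/epsP].
      rewrite in_itv/= -ltr_distlC lt_min negb_and.
      by apply/orP; right; rewrite -leNgt distrC.
    apply: contra; apply: subitvP; rewrite subitvE !bnd_simp.
    by rewrite lerB ?lerD// ge_min lexx.
  have E c e : (forall z, z \in `]x - eps, x + eps[ -> h z = c * z + e) ->
      aff_on `]x - eps, x + eps[%classic c e.
    move=> hce; split=> [|z /hce //]; apply/eqP => c0.
    have /hI/eqP : h x = h (x + eps / 2).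
      by rewrite !hce ?c0 ?mul0r// in_itv/=; apply/andP; split; lra.
    by apply/negP; rewrite lt_eqF//; lra.
  exists eps => //.
  have := epsP 0; rewrite mem_head => /(_ isT); rewrite in_itv/= => n0.
  have := epsP r%:R; rewrite !in_cons eqxx orbT => /(_ isT); rewrite in_itv/= => nr.
  have [xlt0|x0] := ltP x 0.
    exists 1, 0; apply: E => z; rewrite in_itv/= => /andP[z1 z2].
    rewrite mul1r addr0 hid// inE/= in_itv/= negb_and -ltNge.
    apply/orP; left; rewrite ltNge; apply/negP => z0.
    by move/negP: n0; apply; apply/andP; split; lra.
  have [rltx|xr] := ltP r%:R x.
    exists 1, 0; apply: E => z; rewrite in_itv/= => /andP[z1 z2].
    rewrite mul1r addr0 hid// inE/= in_itv/= negb_and -!ltNge.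
    apply/orP; right; rewrite ltNge; apply/negP => z0.
    by move/negP: nr; apply; apply/andP; split; lra.
  have [||||c [e ce]] := hs (x - eps) (x + eps).
  - rewrite leNgt; apply/negP => z0.
    by move/negP: n0; apply; apply/andP; split; lra.
  - lra.
  - rewrite leNgt; apply/negP => z0.
    by move/negP: nr; apply; apply/andP; split; lra.
  - by move=> y ys; apply: epsP; rewrite !in_cons ys !orbT.
  - by exists c, e; apply: E => z /ce.
pose I (n : nat) : set R := if unpickle n is Some pq then
  `]ratr (pq : rat * rat).1, ratr pq.2[%classic else set0.
pose good n := exists ce : R * R, aff_on (I n) ce.1 ce.2.
pose D n : set R := if pselect (good n) is left _ then I n else set0.
have /choice[ce ceP] : forall n, exists ce : R * R, aff_on (D n) ce.1 ce.2.
  move=> n; rewrite /D; case: pselect => [//|_].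
  by exists (1, 0); split => //=; exact: oner_neq0.
exists D, (fst \o ce), (snd \o ce); split.
- move=> n; rewrite /D; case: pselect => // _; rewrite /I.
  by case: unpickle => [pq|]; [exact: measurable_itv|].
- by move=> n; have [] := ceP n.
- by move=> n x Dx; have [_] := ceP n; exact.
- apply: (@sub_countable _ _ _ [set` [:: 0, r%:R & s]]); last first.
    exact/finite_set_countable/finite_seq.
  apply: subset_card_le => x nx /=; apply: contrapT => /negP /loc.
  move=> [eps eps0 [c [e [c0 hce]]]]; apply: nx.
  have [p] : exists q : rat, ratr q \in `]x - eps, x[ by apply: rat_in_itvoo; lra.
  have [q] : exists q : rat, ratr q \in `]x, x + eps[ by apply: rat_in_itvoo; lra.
  rewrite !in_itv/= => /andP[q1 q2] /andP[p1 p2].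
  exists (pickle (p, q)) => //; rewrite /D; case: pselect => [_|].
    by rewrite /I pickleK/= in_itv/= p2.
  case; exists (c, e); rewrite /I pickleK; split => // z /=.
  rewrite in_itv/= => /andP[z1 z2]; apply: hce; rewrite /= in_itv/=.
  by rewrite (lt_trans p1)// (lt_trans z2).
Qed.

Lemma lambdaE r (r_gt0 : (0 < r)%N) (A : set Rm) : measurable A ->
  lambda R r_gt0 A = (r%:R^-1%:E * leb (A `&` `[0%R, r%:R%R]%classic))%E.
Proof.
move=> mA; rewrite -[A in LHS]setIT -integral_indic//.
rewrite integral_uniform//=; last first.
  by apply/measurable_EFinP; exact: measurable_indic.
by rewrite subr0 integral_indic.
Qed.

Let nonsingular_pl r (r_gt0 : (0 < r)%N) (h h' : Rm -> Rm) :
  cancel h h' -> cancel h' h ->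
  {mono h : x / x \in `[0, r%:R : R]} -> ctbl_affine h ->
  exists g : nonsingular (lambda R r_gt0), ns_fun g = h :> (R -> R).
Proof.
move=> hK h'K hI ch; have ch' := ctbl_affine_inv hK h'K ch.
have h'I : {mono h' : x / x \in `[0, r%:R : R]} by move=> x; rewrite -hI h'K.
have mh := ctbl_affine_measurable ch; have mh' := ctbl_affine_measurable ch'.
have mhA A : measurable A -> measurable (h @^-1` A).
  by move=> mA; rewrite -[X in measurable X]setTI; exact: mh.
pose f := mfun_Sub (mem_set mh : h \in mfun).
pose f' := mfun_Sub (mem_set mh' : h' \in mfun).
have null (k : Rm -> Rm) (A : set Rm) : {mono k : x / x \in `[0, r%:R : R]} ->
    ctbl_affine k -> measurable A -> lambda R r_gt0 A = 0%E ->
    lambda R r_gt0 (k @^-1` A) = 0%E.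
  move=> kI ck mA.
  rewrite !lambdaE//; last first.
    by rewrite -[X in measurable X]setTI; exact: (ctbl_affine_measurable ck).
  move=> /eqP; rewrite mule_eq0 eqe invr_eq0 pnatr_eq0 gtn_eqF//= => /eqP A0.
  have -> : k @^-1` A `&` `[0, r%:R]%classic =
            k @^-1` (A `&` `[0, r%:R]%classic).
    by apply/seteqP; split => x /=; rewrite kI.
  by rewrite ctbl_affine_null ?mule0//; exact: measurableI.
have d1 : distribution (lambda R r_gt0) f `<< lambda R r_gt0.
  by apply/null_content_dominatesP => A mA A0; exact: (null h).
have d2 : lambda R r_gt0 `<< distribution (lambda R r_gt0) f.
  apply/null_content_dominatesP => A mA A0.
  have -> : A = h' @^-1` (h @^-1` A).
    by apply/seteqP; split => x; rewrite /= h'K.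
  by apply: null => //; exact: mhA.
by exists (@Nonsingular _ _ _ _ f f' hK h'K d1 d2).
Qed.

(* Quasi-invariance of [lambda]: asking for nonsingularity in the definitions of
   [thompson_F] and [thompson_G] excludes no element of the groups. *)
Lemma thompson_F_nonsingular n r (r_gt0 : (0 < r)%N) (h : R -> R) :
  in_F n r h -> exists2 g, @thompson_F R n r r_gt0 g & ns_fun g = h :> (R -> R).
Proof.
move=> hF; have [hid [h' [hI h'I hK h'K _]] _ hpl _] := hF.
pose k x := if x \in `[0, r%:R : R] then h' x else x.
have hIE : {mono h : x / x \in `[0, r%:R : R]}.
  by move=> x; apply/idP/idP; [apply: contraTT => xI; rewrite hid|exact: hI].
have kK : cancel h k.
  by move=> x; rewrite /k hIE; case: ifPn => [/hK //|xI]; rewrite hid.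
have hk : cancel k h.
  by move=> x; rewrite /k; case: ifPn => [/h'K //|xI]; rewrite hid.
have [|g gh] := @nonsingular_pl r r_gt0 h k kK hk hIE.
  exact: ctbl_affine_pl (can_inj kK) hpl hid.
by exists g => //; rewrite /thompson_F/= gh.
Qed.

Lemma thompson_G_nonsingular n r (r_gt0 : (0 < r)%N) (h : R -> R) :
  in_G n r h -> exists2 g, @thompson_G R n r r_gt0 g & ns_fun g = h :> (R -> R).
Proof.
move=> hG; have [hid [hI hinj hsurj] _ hpl _] := hG.
have hIE' x : h x \in `[0, r%:R : R[ = (x \in `[0, r%:R : R[).
  by apply/idP/idP; [apply: contraTT => xI; rewrite hid|move=> xI; exact: hI].
have hrr : h r%:R = r%:R by rewrite hid// inE/= in_itv/= ltxx andbF.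
have hIE : {mono h : x / x \in `[0, r%:R : R]}.
  have E y : y \in `[0, r%:R : R] = (y == r%:R) || (y \in `[0, r%:R : R[).
    rewrite !in_itv/= [X in _ && X]le_eqVlt; case: eqP => [->|]//=.
    by rewrite ler0n.
  have hr x : (h x == r%:R) = (x == r%:R).
    apply/eqP/eqP => [hx|->//]; have [xI|xI] := boolP (x \in `[0, r%:R : R[).
      by have := hIE' x; rewrite xI hx in_itv/= ltxx andbF.
    by rewrite -hx hid.
  by move=> x; rewrite !E hIE' hr.
have inj : injective h.
  move=> x y hxy; have := hIE' x; rewrite hxy hIE'.
  case: (boolP (y \in _)) => yI /esym xI.
    by apply: hinj => //; rewrite inE.
  transitivity (h x); first by rewrite hid// inE/= xI.
  by rewrite hxy hid// inE/=.
have /choice[k hk] : forall y, exists x, h x = y.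
  move=> y; have [yI|yI] := boolP (y \in `[0, r%:R : R[).
    by have [x _ <-] := hsurj _ yI; exists x.
  by exists y; rewrite hid.
have kK : cancel h k by move=> x; apply: inj; rewrite hk.
have [|g gh] := @nonsingular_pl r r_gt0 h k kK hk hIE.
  apply: ctbl_affine_pl inj hpl _ => x xI; apply: hid; move: xI.
  by apply: contra => /le_trans; apply; rewrite subitvE !bnd_simp.
by exists g => //; rewrite /thompson_G/= gh.
Qed.

End nonsingularity.

(* Main.v *)
Require Import Defs.
From HB Require Import structures.
From mathcomp Require Import all_boot all_order all_algebra.
From mathcomp Require Import finmap complex.
From mathcomp Require Import all_classical all_reals all_analysis.
From mathcomp Require Import measurable_realfun ring lra.

(* For n-adic [a], [p] and [s = n ^ k], let [swap a p s] expand [a, a + p] by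
   the factor [s], contract the next interval, of length [s p], by the same
   factor, and be the identity elsewhere; it belongs to F and to G. These maps
   alone act irreducibly. Let V be a closed invariant subspace.

   First, V is stable under multiplication by indicators. Indeed, take f in V and
   q in ]0, r]. A swap supported in [0, q] fixes the part of f living on ]q, r]
   and, when s is small, moves a function supported in a compact subset of ]0, q[
   off its support. Averaging f with its image thus halves the squared norm of the
   latter part; iterating, f 1_]q, r] is in V. The pi-lambda theorem
   replaces ]q, r] by any Borel set.

   Next, let f in V be nonzero and let x be a Lebesgue point of Re f, Im f and
   |f|^2 with f x <> 0. A swap with large s expands a small interval to the right
   of x to nearly all of [x, r], so that, in the limit, 1_[x, r] is in V.
   A second swap, expanding an interval near r, gives that 1 is in V, hence so are
   all indicators, all simple functions, and all of L^2. *)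

Set Implicit Arguments.
Unset Strict Implicit.
Unset Printing Implicit Defensive.

Import Order.TTheory GRing.Theory Num.Theory.
Import numFieldNormedType.Exports.

Local Open Scope classical_set_scope.
Local Open Scope ring_scope.
Local Open Scope complex_scope.

(** * Squared modulus of a complex number *)

Section sqc.
Context (R : realType).
Implicit Types (z w : R[i]) (x : R).

(** A real polynomial in the two parts: measurability is immediate and identities are left to
    [ring]. *)
Definition sqc z : R := complex.Re z ^+ 2 + complex.Im z ^+ 2.

Lemma sqc_ge0 z : 0 <= sqc z.
Proof. by rewrite addr_ge0// sqr_ge0. Qed.

Lemma sqc0 : sqc 0 = 0.
Proof. by rewrite /sqc/= expr0n/= addr0. Qed.

Lemma sqcN z : sqc (- z) = sqc z.
Proof. by case: z => a b; rewrite /sqc/= !sqrrN. Qed.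

Lemma sqcM z w : sqc (z * w) = sqc z * sqc w.
Proof. by case: z w => [a b] [c d]; rewrite /sqc/=; ring. Qed.

Lemma sqcR x : sqc x%:C = x ^+ 2.
Proof. by rewrite /sqc/= expr0n addr0. Qed.

(** The parallelogram law with the term |z - w|^2 dropped. *)
Lemma sqcD z w : sqc (z + w) <= 2 * sqc z + 2 * sqc w.
Proof.
case: z w => [a b] [c d]; rewrite /sqc/= -subr_ge0.
have := sqr_ge0 (a - c); have := sqr_ge0 (b - d); nra.
Qed.

Lemma sqc_half z w : sqc ((2^-1)%:C * (z + w)) <= 2^-1 * (sqc z + sqc w).
Proof. by rewrite sqcM sqcR; have := sqcD z w; lra. Qed.

(** Source of the gain in the averaging argument: convexity alone gives the factor 1/2 of
    [sqc_half], disjoint supports give 1/4. *)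
Lemma sqc_half_disj z w : z = 0 \/ w = 0 ->
  sqc ((2^-1)%:C * (z + w)) = 4^-1 * (sqc z + sqc w).
Proof.
by rewrite sqcM sqcR => -[] ->; rewrite sqc0 ?addr0 ?add0r; congr (_ * _); field.
Qed.

Lemma normcE_sqc z : ComplexField.Normc.normc z = Num.sqrt (sqc z).
Proof. by case: z. Qed.

End sqc.

(** * Energy of complex functions *)

Section L2_theory.
Context d (T : measurableType d) (R : realType) (mu : probability T R).
Implicit Types (f g : T -> R[i]) (V : set (T -> R[i])).

Lemma aeS (P Q : set T) : (forall x, P x -> Q x) ->
  {ae mu, forall x, P x} -> {ae mu, forall x, Q x}.
Proof. by move=> PQ; apply: filterS. Qed.

Lemma aeS2 (P Q S : set T) : (forall x, P x -> Q x -> S x) ->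
  {ae mu, forall x, P x} -> {ae mu, forall x, Q x} -> {ae mu, forall x, S x}.
Proof. by move=> PQ; apply: filterS2. Qed.

Definition cmeas f := measurable_fun setT (fun x => complex.Re (f x)) /\
  measurable_fun setT (fun x => complex.Im (f x)).

(** Squared L2 norm (see [L2normE]), with extended real values so that it makes sense before
    integrability is known. *)
Definition energy f : \bar R := (\int[mu]_x (sqc (f x))%:E)%E.

Lemma measurable_sqc f : cmeas f -> measurable_fun setT (fun x => sqc (f x)).
Proof.
by move=> [mr mi]; apply: measurable_funD; apply: measurable_funX.
Qed.

Lemma measurable_sqcE f : cmeas f ->
  measurable_fun setT (fun x => (sqc (f x))%:E).
Proof. by move=> /measurable_sqc mf; exact/measurable_EFinP. Qed.
Hint Resolve measurable_sqcE : core.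

Lemma cmeas_cst (z : R[i]) : cmeas (fun=> z).
Proof. by split. Qed.

Lemma cmeasD f g : cmeas f -> cmeas g -> cmeas (fun x => f x + g x).
Proof.
move=> [a b] [c e]; split.
- rewrite (_ : (fun x => _) = (fun x => complex.Re (f x) + complex.Re (g x))).
    exact: measurable_funD.
  by apply/funext => x; case: (f x) (g x) => ? ? [].
- rewrite (_ : (fun x => _) = (fun x => complex.Im (f x) + complex.Im (g x))).
    exact: measurable_funD.
  by apply/funext => x; case: (f x) (g x) => ? ? [].
Qed.

Lemma cmeasM f g : cmeas f -> cmeas g -> cmeas (fun x => f x * g x).
Proof.
move=> [a b] [c e]; split.
- rewrite (_ : (fun x => _) = (fun x => complex.Re (f x) * complex.Re (g x) -
      complex.Im (f x) * complex.Im (g x))).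
    by apply: measurable_funB; exact: measurable_funM.
  by apply/funext => x; case: (f x) (g x) => ? ? [].
- rewrite (_ : (fun x => _) = (fun x => complex.Re (f x) * complex.Im (g x) +
      complex.Im (f x) * complex.Re (g x))).
    by apply: measurable_funD; exact: measurable_funM.
  by apply/funext => x; case: (f x) (g x) => ? ? [].
Qed.

Lemma cmeas_real (u : T -> R) :
  measurable_fun setT u -> cmeas (fun x => (u x)%:C).
Proof. by move=> mu'; split => //=; exact: measurable_cst. Qed.

Lemma cmeasZ (z : R[i]) f : cmeas f -> cmeas (fun x => z * f x).
Proof. by move=> mf; apply: cmeasM => //; exact: cmeas_cst. Qed.

Lemma cmeasB f g : cmeas f -> cmeas g -> cmeas (fun x => f x - g x).
Proof.
move=> mf mg; rewrite (_ : (fun x => _) = (fun x => f x + (-1) * g x)).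
  by apply: cmeasD => //; exact: cmeasZ.
by apply/funext => x; rewrite mulN1r.
Qed.

Lemma cmeas_indic (A : set T) : measurable A -> cmeas (fun x => (\1_A x)%:C).
Proof. by move=> mA; apply: cmeas_real; exact: measurable_indic. Qed.

Definition cutoff (A : set T) f : T -> R[i] := fun x => (\1_A x)%:C * f x.

Lemma cutoff_in (A : set T) f x : A x -> cutoff A f x = f x.
Proof. by move=> Ax; rewrite /cutoff indicE mem_set// mul1r. Qed.

Lemma cutoff_out (A : set T) f x : ~ A x -> cutoff A f x = 0.
Proof. by move=> nAx; rewrite /cutoff indicE memNset// mul0r. Qed.

Lemma cmeas_cutoff f (A : set T) : cmeas f -> measurable A -> cmeas (cutoff A f).
Proof. by move=> mf mA; apply: cmeasM => //; exact: cmeas_indic. Qed.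

Lemma sqc_cutoff (A : set T) f x : sqc (cutoff A f x) = \1_A x * sqc (f x).
Proof.
by rewrite /cutoff sqcM sqcR indicE; case: (_ \in _); rewrite ?expr1n ?expr0n.
Qed.

Lemma sqc_cutoff_le (A : set T) f x : sqc (cutoff A f x) <= sqc (f x).
Proof.
by rewrite sqc_cutoff indicE; case: (_ \in _); rewrite ?mul1r ?mul0r ?sqc_ge0.
Qed.

Lemma energy_ge0 f : (0 <= energy f)%E.
Proof. by apply: integral_ge0 => x _; rewrite lee_fin sqc_ge0. Qed.

Lemma energy_le f g : cmeas f -> cmeas g ->
  (forall x, sqc (f x) <= sqc (g x)) -> (energy f <= energy g)%E.
Proof.
move=> mf mg fg; apply: ge0_le_integral => //=.
- by move=> x _; rewrite lee_fin sqc_ge0.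
- exact: measurable_sqcE.
- exact: measurable_sqcE.
- by move=> x _; rewrite lee_fin.
Qed.

Lemma energyD_le f g : cmeas f -> cmeas g ->
  (energy (fun x => f x + g x)%R <= 2%:E * energy f + 2%:E * energy g)%E.
Proof.
move=> mf mg; rewrite /energy -!ge0_integralZl//=; last 4 first.
- exact: measurable_sqcE.
- by move=> x _; rewrite lee_fin sqc_ge0.
- exact: measurable_sqcE.
- by move=> x _; rewrite lee_fin sqc_ge0.
rewrite -ge0_integralD//=; last 4 first.
- by move=> x _; rewrite -EFinM lee_fin mulr_ge0// sqc_ge0.
- by apply: measurable_funeM; exact: measurable_sqcE.
- by move=> x _; rewrite -EFinM lee_fin mulr_ge0// sqc_ge0.
- by apply: measurable_funeM; exact: measurable_sqcE.
apply: ge0_le_integral => //=.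
- by move=> x _; rewrite lee_fin sqc_ge0.
- by apply: measurable_sqcE; exact: cmeasD.
- by apply: emeasurable_funD; apply: measurable_funeM; exact: measurable_sqcE.
- by move=> x _; rewrite -!EFinM -EFinD lee_fin sqcD.
Qed.

Lemma energy_half_le f g : cmeas f -> cmeas g ->
  (energy (fun x => (2^-1)%:C * (f x + g x))%R
    <= (2^-1)%:E * (energy f + energy g))%E.
Proof.
move=> mf mg; rewrite /energy -ge0_integralD//=; last 4 first.
- by move=> x _; rewrite lee_fin sqc_ge0.
- exact: measurable_sqcE.
- by move=> x _; rewrite lee_fin sqc_ge0.
- exact: measurable_sqcE.
rewrite -ge0_integralZl//=; last 2 first.
- by apply: emeasurable_funD; exact: measurable_sqcE.
- by move=> x _; rewrite -EFinD lee_fin addr_ge0// sqc_ge0.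
apply: ge0_le_integral => //=.
- by move=> x _; rewrite lee_fin sqc_ge0.
- by apply: measurable_sqcE; apply: cmeasZ; exact: cmeasD.
- apply: measurable_funeM.
  by apply: emeasurable_funD; exact: measurable_sqcE.
- by move=> x _; rewrite -EFinD -EFinM lee_fin sqc_half.
Qed.

Lemma energy_half_disj f g : cmeas f -> cmeas g ->
  (forall x, f x = 0 \/ g x = 0) ->
  energy (fun x => (2^-1)%:C * (f x + g x)) =
    ((4^-1)%:E * (energy f + energy g))%E.
Proof.
move=> mf mg fg0; rewrite /energy -ge0_integralD//=; last 4 first.
- by move=> x _; rewrite lee_fin sqc_ge0.
- exact: measurable_sqcE.
- by move=> x _; rewrite lee_fin sqc_ge0.
- exact: measurable_sqcE.
rewrite -ge0_integralZl//=; last 2 first.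
- by apply: emeasurable_funD; exact: measurable_sqcE.
- by move=> x _; rewrite -EFinD lee_fin addr_ge0// sqc_ge0.
by apply: eq_integral => x _; rewrite -EFinD -EFinM sqc_half_disj.
Qed.

Lemma energyZ (z : R[i]) f : cmeas f ->
  energy (fun x => z * f x) = ((sqc z)%:E * energy f)%E.
Proof.
move=> mf; rewrite /energy -ge0_integralZl//=; last 3 first.
- exact: measurable_sqcE.
- by move=> x _; rewrite lee_fin sqc_ge0.
- by rewrite lee_fin sqc_ge0.
by apply: eq_integral => x _; rewrite -EFinM sqcM.
Qed.

Lemma ae_eq_energy f g : cmeas f -> cmeas g -> f = g %[ae mu] ->
  energy f = energy g.
Proof.
move=> mf mg fg; apply: ge0_ae_eq_integral => //=.
- exact: measurable_sqcE.
- exact: measurable_sqcE.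
- by move=> x _; rewrite lee_fin sqc_ge0.
- by move=> x _; rewrite lee_fin sqc_ge0.
- by apply: filterS fg => x /(_ I) fg _; rewrite fg.
Qed.

Lemma energy_cst (z : R[i]) : energy (fun=> z) = (sqc z)%:E.
Proof. by rewrite /energy integral_cst//= probability_setT mule1. Qed.

Lemma energy_dominated_cvg0 f (g_ : (T -> R[i])^nat) : cmeas f ->
  (forall n, cmeas (g_ n)) -> (energy f < +oo)%E ->
  (forall n x, sqc (g_ n x) <= sqc (f x)) ->
  {ae mu, forall x, (sqc (g_ n x) @[n --> \oo] --> 0)} ->
  energy (g_ n) @[n --> \oo] --> 0%E.
Proof.
move=> mf mg foo gf g0.
have [] := @dominated_convergence _ _ _ mu setT measurableT
  (fun n x => (sqc (g_ n x))%:E) (cst 0%E) (fun x => (sqc (f x))%:E).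
- by move=> n; exact: measurable_sqcE.
- exact: measurable_cst.
- by apply: filterS g0 => x g0 _; apply: cvg_EFin; [exact: nearW|exact: g0].
- apply/integrableP; split; first exact: measurable_sqcE.
  apply: le_lt_trans foo; rewrite le_eqVlt; apply/orP; left; apply/eqP.
  by apply: eq_integral => x _; rewrite gee0_abs// lee_fin sqc_ge0.
- by apply: aeW => x n _; rewrite gee0_abs ?lee_fin ?sqc_ge0.
by move=> _ _; rewrite integral0.
Qed.

Lemma energy_cutoff_cvg0 f (A_ : (set T)^nat) : cmeas f -> (energy f < +oo)%E ->
  (forall n, measurable (A_ n)) ->
  {ae mu, forall x, \forall n \near \oo, ~ A_ n x} ->
  energy (cutoff (A_ n) f) @[n --> \oo] --> 0%E.
Proof.
move=> mf foo mA A0; apply: (@energy_dominated_cvg0 f) => //.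
- by move=> n; exact: cmeas_cutoff.
- by move=> n x; exact: sqc_cutoff_le.
- apply: filterS A0 => x A0; apply: cvg_near_cst.
  by apply: filterS A0 => n nA; rewrite cutoff_out// sqc0.
Qed.

Lemma cvge0_lt (u_ : (\bar R)^nat) (e : R) : u_ @ \oo --> 0%E -> 0 < e ->
  \forall n \near \oo, (u_ n < e%:E)%E.
Proof.
move=> u0 e0; apply: (u0 [set y | (y < e%:E)%E]); apply: open_nbhs_nbhs.
by split; [exact: open_ereal_lt_ereal|rewrite /= lte_fin].
Qed.

Lemma L2normE f : L2norm mu f = (energy f `^ 2^-1)%E.
Proof.
rewrite /L2norm unlock /energy; congr (_ `^ _)%E; apply: eq_integral => x _.
rewrite normcE_sqc gee0_abs ?lee_fin ?sqrtr_ge0// poweR_EFin powR_mulrn ?sqrtr_ge0//.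
by rewrite sqr_sqrtr ?sqc_ge0.
Qed.

Lemma L2E f : L2 mu f <-> cmeas f /\ (energy f < +oo)%E.
Proof.
have E : (L2norm mu f < +oo)%E <-> (energy f < +oo)%E.
  rewrite L2normE; have := energy_ge0 f; case: (energy f) => [x| |] // _.
    by rewrite poweR_EFin !ltry.
  by rewrite poweRyr ?invr_eq0.
by split; [move=> [? ? /E]|move=> [[? ?] /E]].
Qed.

Lemma L2norm_lt f (e : R) : 0 < e -> (energy f < (e ^+ 2)%:E)%E ->
  (L2norm mu f < e%:E)%E.
Proof.
move=> e0; rewrite L2normE; have := energy_ge0 f.
case: (energy f) => [x| |] //; rewrite poweR_EFin !lee_fin !lte_fin => x0 xe.
have -> : e = (e ^+ 2) `^ 2^-1.
  by rewrite -powR_mulrn ?ltW// -powRrM mulfV// powRr1 ?ltW.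
by rewrite gt0_ltr_powR// ?nnegrE ?invr_gt0// sqr_ge0.
Qed.

(** * Closed subspaces: limits and modifications on null sets *)

Section closed_subspace_theory.
Context V (cV : closed_subspace mu V).

Lemma csub_cmeas f : V f -> cmeas f.
Proof. by move=> /(csub_L2 cV) /L2E[]. Qed.

Lemma csub_energy f : V f -> (energy f < +oo)%E.
Proof. by move=> /(csub_L2 cV) /L2E[]. Qed.

Lemma csubZ z f : V f -> V (fun x => z * f x).
Proof.
move=> Vf; have := csub_linear cV z Vf (csub_0 cV).
by congr V; apply/funext => x; rewrite addr0.
Qed.

Lemma csubD f g : V f -> V g -> V (fun x => f x + g x).
Proof.
move=> Vf Vg; have := csub_linear cV 1 Vf Vg.
by congr V; apply/funext => x; rewrite mul1r.
Qed.

Lemma csubB f g : V f -> V g -> V (fun x => f x - g x).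
Proof.
move=> Vf Vg; have := csub_linear cV (-1) Vg Vf.
by congr V; apply/funext => x; rewrite mulN1r addrC.
Qed.

(** Membership of f in [L2] is derived, not assumed: f = (f - g) + g, both terms having finite
    energy. Norm distance below e is obtained from energy below e^2. *)
Lemma csub_lim f : cmeas f ->
  (forall e, 0 < e -> exists2 g, V g & (energy (fun x => f x - g x)%R < e%:E)%E) ->
  V f.
Proof.
move=> mf fV; apply: (csub_closed cV).
  apply/L2E; split => //; have [g Vg fg] := fV _ ltr01.
  have mg := csub_cmeas Vg.
  have -> : f = (fun x => (f x - g x) + g x) by apply/funext => x; rewrite subrK.
  apply: (le_lt_trans (energyD_le _ _)) => //; first exact: cmeasB.
  rewrite lte_add_pinfty// ltey_eq fin_numM//.
    rewrite ge0_fin_numE ?energy_ge0//; exact: lt_trans fg (ltry _).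
  by rewrite ge0_fin_numE ?energy_ge0//; exact: csub_energy.
move=> e e0; have [g Vg fg] := fV (e ^+ 2) (exprn_gt0 2 e0).
by exists g => //; exact: L2norm_lt.
Qed.

Lemma csub_cvg f (g_ : (T -> R[i])^nat) : cmeas f -> (forall n, V (g_ n)) ->
  energy (fun x => f x - g_ n x) @[n --> \oo] --> 0%E -> V f.
Proof.
move=> mf Vg fg; apply: csub_lim => // e e0.
have : \forall n \near \oo, (energy (fun x => f x - g_ n x)%R < e%:E)%E.
  exact: cvge0_lt.
by move=> [n _ /(_ _ (leqnn n))]; exists (g_ n).
Qed.

(** A modification on a null set is at distance 0, so f itself approximates g. Koopman images of
    swaps are only computed almost everywhere, whence the need for this form. *)
Lemma csub_ae f g : V f -> cmeas g -> g = f %[ae mu] -> V g.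
Proof.
move=> Vf mg gf; apply: csub_lim => // e e0; exists f => //.
have mf := csub_cmeas Vf.
rewrite (@ae_eq_energy _ (fun=> 0)).
- by rewrite energy_cst sqc0 lte_fin.
- exact: cmeasB.
- exact: cmeas_cst.
- by apply: filterS gf => x /(_ I) gf _; rewrite gf subrr.
Qed.

End closed_subspace_theory.

(** * Radon-Nikodym densities and isometry of the Koopman operators *)

Section koopman_theory.
Variable g : nonsingular mu.
Local Notation dens := (transported_density g).
Local Notation RN := (Radon_Nikodym
    (charge_of_finite_measure (distribution mu (ns_fun g))) mu).

Let RN_fin x : RN x \is a fin_num.
Proof. by apply: Radon_Nikodym_fin_num; exact: ns_dominates. Qed.

Let densE x : (dens x)%:E = RN x.
Proof. by rewrite /transported_density fineK. Qed.

Lemma integrable_density : mu.-integrable setT (fun x => (dens x)%:E).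
Proof.
under eq_fun do rewrite densE.
by apply: Radon_Nikodym_integrable; exact: ns_dominates.
Qed.

Lemma measurable_density : measurable_fun setT dens.
Proof. by apply/measurable_EFinP; exact: measurable_int integrable_density. Qed.

Lemma integral_density (A : set T) : measurable A ->
  (\int[mu]_(x in A) (dens x)%:E = mu (ns_fun g @^-1` A))%E.
Proof.
move=> mA; under eq_integral do rewrite densE.
by rewrite -Radon_Nikodym_integral//; exact: ns_dominates.
Qed.

(** Uniqueness of densities, localised to A: integrable functions with the same integral over every
    measurable subset of A agree almost everywhere on A. *)
Lemma density_eq (A : set T) (c : R) : measurable A ->
  (forall B, B `<=` A -> measurable B ->
    mu (ns_fun g @^-1` B) = (c%:E * mu B)%E) ->
  {ae mu, forall x, A x -> dens x = c}.
Proof.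
move=> mA H.
have iA : mu.-integrable A (fun x => (dens x)%:E).
  exact: integrableS measurableT mA (@subsetT _ _) integrable_density.
have : ae_eq mu A (fun x => (dens x)%:E) (cst c%:E).
  apply: integral_ae_eq => // B BA mB.
  by rewrite integral_density// H// integral_cst.
by apply: filterS => x /[apply] -[].
Qed.

(** On the set where the density is negative, its integral over any measurable subset is at most 0,
    yet it is the measure of a preimage; so the density vanishes a.e. there. Nonnegativity is what
    makes the square of [Num.sqrt] return the density. *)
Lemma density_ge0 : {ae mu, forall x, 0 <= dens x}.
Proof.
pose N := [set x | dens x < 0].
have mN : measurable N.
  have -> : N = setT `&` dens @^-1` `]-oo, 0[%classic.
    by rewrite setTI; apply/seteqP; split => x; rewrite /N/= in_itv.
  by apply: measurable_density => //; exact: measurable_itv.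
have : ae_eq mu N (fun x => (dens x)%:E) (cst 0%E).
  apply: integral_ae_eq => // [|B BN mB].
    exact: integrableS measurableT mN (@subsetT _ _) integrable_density.
  apply/eqP; rewrite eq_le integral_density// integral0 measure_ge0 andbT.
  rewrite -integral_density// -[leRHS](integral0 mu B); apply: le_integral => //.
  - exact: integrableS measurableT mB (@subsetT _ _) integrable_density.
  - exact: integrable0.
  - by move=> x; rewrite inE => /BN; rewrite /N/= lee_fin => /ltW.
apply: filterS => x xN; rewrite leNgt; apply/negP => x0.
by have [d0] := xN x0; rewrite d0 ltxx in x0.
Qed.

Lemma cmeas_koopman f : cmeas f -> cmeas (koopman g f).
Proof.
move=> [fr fi]; apply: cmeasM.
  apply: cmeas_real.
  exact: (measurableT_comp (continuous_measurable_fun (@sqrt_continuous R))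
    measurable_density).
by split; [exact: (measurableT_comp fr)|exact: (measurableT_comp fi)].
Qed.

(** Change of variables: integrating |f o g^-1|^2 times the density against mu is integrating |f o
    g^-1|^2 against the image measure, that is, |f|^2 against mu. *)
Lemma energy_koopman f : cmeas f -> (energy f < +oo)%E ->
  energy (koopman g f) = energy f.
Proof.
move=> mf foo; set nu := distribution mu (ns_fun g).
pose F x := (sqc (f (ns_inv g x)))%:E.
have mfg : cmeas (fun x => f (ns_inv g x)).
  case: mf => fr fi.
  by split; [exact: (measurableT_comp fr)|exact: (measurableT_comp fi)].
have mF : measurable_fun setT F by exact: measurable_sqcE.
have F0 x : (0 <= F x)%E by rewrite lee_fin sqc_ge0.
have FE : (\int[nu]_x F x = energy f)%E.
  rewrite /nu ge0_integral_distribution//.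
  by apply: eq_integral => x _; rewrite /F /= ns_funK.
have iF : nu.-integrable setT F.
  apply/integrableP; split => //; apply: le_lt_trans foo; rewrite -FE.
  rewrite le_eqVlt; apply/orP; left; apply/eqP.
  by apply: eq_integral => x _; rewrite gee0_abs.
rewrite -FE -(Radon_Nikodym_change_of_variables (ns_dominates g) measurableT iF).
apply: ae_eq_integral => //.
- by apply: measurable_sqcE; exact: cmeas_koopman.
- apply: emeasurable_funM => //; apply: measurable_int.
  by apply: Radon_Nikodym_integrable; exact: ns_dominates.
- apply: filterS density_ge0 => x d0 _.
  by rewrite /F -densE -EFinM /koopman sqcM sqcR sqr_sqrtr// mulrC.
Qed.

End koopman_theory.
End L2_theory.

(** * Ring operations in Z[1/n] *)

Section adic.
Context (R : realType) (n : nat) (n_gt1 : (1 < n)%N).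

Let n0 : n%:R != 0 :> R.
Proof. by rewrite pnatr_eq0 -lt0n (ltn_trans _ n_gt1). Qed.

Lemma Zinv_int (m : int) : Zinv n (m%:~R : R).
Proof. by exists m, 0%N; rewrite expr0 divr1. Qed.

Lemma Zinv_nat (m : nat) : Zinv n (m%:R : R).
Proof. exact: (Zinv_int m). Qed.

Lemma ZinvN (x : R) : Zinv n x -> Zinv n (- x).
Proof. by move=> [m [k ->]]; exists (- m), k; rewrite mulrNz mulNr. Qed.

Lemma ZinvD (x y : R) : Zinv n x -> Zinv n y -> Zinv n (x + y).
Proof.
move=> [m [k ->]] [m' [k' ->]].
exists (m * n%:Z ^+ k' + m' * n%:Z ^+ k), (k + k')%N.
have nk j : n%:R ^+ j != 0 :> R by rewrite expf_neq0.
rewrite intrD !intrM !rmorphXn/= exprD -pmulrn.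
by field; rewrite !nk.
Qed.

Lemma ZinvB (x y : R) : Zinv n x -> Zinv n y -> Zinv n (x - y).
Proof. by move=> zx zy; apply: ZinvD => //; exact: ZinvN. Qed.

Lemma ZinvM (x y : R) : Zinv n x -> Zinv n y -> Zinv n (x * y).
Proof.
move=> [m [k ->]] [m' [k' ->]].
by exists (m * m'), (k + k')%N; rewrite intrM exprD mulf_div.
Qed.

Lemma Zinv_exp (k : int) : Zinv n (n%:R ^ k : R).
Proof.
case: k => k; last by exists 1, k.+1; rewrite mul1r NegzE -exprnN.
by rewrite -exprnP -natrX; exact: Zinv_nat.
Qed.

End adic.

(** * Swap maps of the real line *)

Section swap.
Context (R : realType).
Implicit Types (a p s x y l : R).

Definition clamp l x := Num.max 0 (Num.min x l).

(** For p, s >= 0, the two [clamp] terms are the lengths of [a, a + p] and of [a + p, a + p + s p]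
    to the left of x. They correct the slope 1 to s, then to s^-1, and cancel to the right of both
    intervals. A single formula makes continuity immediate. *)
Definition swap a p s x :=
  x + (s - 1) * clamp p (x - a) + (s^-1 - 1) * clamp (s * p) (x - a - p).

Lemma clamp0 l x : x <= 0 -> clamp l x = 0.
Proof. by move=> x0; rewrite /clamp max_l// ge_min x0. Qed.

Lemma clamp_id l x : 0 <= x -> x <= l -> clamp l x = x.
Proof. by move=> x0 xl; rewrite /clamp min_l// max_r. Qed.

Lemma clamp_max l x : 0 <= l -> l <= x -> clamp l x = l.
Proof. by move=> l0 lx; rewrite /clamp min_r// max_r. Qed.

Lemma continuous_clamp l : continuous (clamp l).
Proof.
move=> x; rewrite (_ : clamp l = (cst 0 : R -> R) \max (@id R \min cst l))//.
apply: continuous_max; first exact: cvg_cst.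
by apply: continuous_min; [exact: cvg_id|exact: cvg_cst].
Qed.

Lemma clamp_le l x y : 0 <= l -> x <= y ->
  0 <= clamp l y - clamp l x <= y - x.
Proof.
move=> l0 xy; have [x0|x0] := leP x 0.
  rewrite (clamp0 l x0) subr0; have [y0|y0] := leP y 0.
    by rewrite (clamp0 l y0); apply/andP; split; lra.
  have [yl|yl] := leP y l.
    by rewrite (clamp_id (ltW y0) yl); apply/andP; split; lra.
  by rewrite (clamp_max l0 (ltW yl)); apply/andP; split; lra.
have [xl|xl] := leP x l; last first.
  rewrite (clamp_max l0 (ltW xl)) clamp_max//; last lra.
  by apply/andP; split; lra.
rewrite (clamp_id (ltW x0) xl).
have [yl|yl] := leP y l.
  by rewrite clamp_id; [apply/andP; split; lra|lra|].
by rewrite (clamp_max l0 (ltW yl)); apply/andP; split; lra.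
Qed.

Lemma swap_left a p s x : 0 <= p -> 0 < s -> x <= a -> swap a p s x = x.
Proof.
by move=> p0 s0 xa; rewrite /swap !clamp0 ?mulr0 ?addr0//; lra.
Qed.

Lemma swap_fst a p s x : a <= x -> x <= a + p -> swap a p s x = a + s * (x - a).
Proof.
move=> ax xp; rewrite /swap clamp_id; [|lra..].
by rewrite clamp0; [ring|lra].
Qed.

Lemma swap_snd a p s x : 0 <= p -> 0 < s ->
  a + p <= x -> x <= a + p + s * p -> swap a p s x = a + s * p + (x - a - p) / s.
Proof.
move=> p0 s0 ax xp; rewrite /swap clamp_max; [|lra..].
rewrite clamp_id; [|lra..].
by field; rewrite gt_eqF.
Qed.

Lemma swap_right a p s x : 0 <= p -> 0 < s ->
  a + p + s * p <= x -> swap a p s x = x.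
Proof.
move=> p0 s0 ax; have sp0 : 0 <= s * p by rewrite mulr_ge0// ltW.
rewrite /swap !clamp_max//; [|lra..].
by field; rewrite gt_eqF.
Qed.

(** The inverse is again a swap: the image of the first interval has length s p and is contracted
    back by s, the image of the second has length s^-1 (s p) = p and is expanded back. *)
Lemma swapK a p s : 0 <= p -> 0 < s ->
  cancel (swap a p s) (swap a (s * p) s^-1).
Proof.
move=> p0 s0 x; have s0' : s != 0 by rewrite gt_eqF.
have sp0 : 0 <= s * p by rewrite mulr_ge0// ltW.
have si0 : 0 < s^-1 by rewrite invr_gt0.
have sK : s^-1 * (s * p) = p by rewrite mulKf.
have [xa|xa] := leP x a; first by rewrite (swap_left p0 s0 xa) swap_left.
have [x1|x1] := leP x (a + p).
  rewrite (swap_fst _ (ltW xa) x1) swap_fst.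
  - by rewrite addrAC subrr add0r mulKf// addrC subrK.
  - by rewrite lerDl mulr_ge0 ?ltW// subr_gt0.
  - by rewrite lerD2l ler_pM2l//; lra.
have [x2|x2] := leP x (a + p + s * p).
  have q0 : 0 <= (x - a - p) / s by rewrite mulr_ge0 ?(ltW si0)//; lra.
  have q1 : (x - a - p) / s <= p by rewrite ler_pdivrMr//; lra.
  rewrite (swap_snd p0 s0 (ltW x1) x2) swap_snd//; last 2 first.
  - by rewrite lerDl.
  - by rewrite sK; lra.
  by rewrite sK; field.
by rewrite (swap_right p0 s0 (ltW x2)) swap_right// sK; lra.
Qed.

Lemma swapVK a p s : 0 <= p -> 0 < s ->
  cancel (swap a (s * p) s^-1) (swap a p s).
Proof.
move=> p0 s0; have s0' : s != 0 by rewrite gt_eqF.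
have := @swapK a (s * p) s^-1; rewrite mulKf// invrK; apply.
  by rewrite mulr_ge0// ltW.
by rewrite invr_gt0.
Qed.

Lemma continuous_swap a p s : continuous (swap a p s).
Proof.
move=> x; have shift (c : R) (f : R -> R) :
    {for x, continuous f} -> {for x, continuous (fun y => f y - c)}.
  by move=> cf; apply: cvgB => //; exact: cvg_cst.
have clampc (c l : R) (f : R -> R) : {for x, continuous f} ->
    {for x, continuous (fun y => c * clamp l (f y))}.
  move=> cf; apply: cvgM; first exact: cvg_cst.
  exact: (continuous_comp cf (@continuous_clamp l _)).
apply: cvgD; first (apply: cvgD; first exact: cvg_id).
- exact: (clampc _ _ _ (shift a id cvg_id)).
- exact: (clampc _ _ _ (shift p _ (shift a id cvg_id))).
Qed.

(** The increment is (y - x) + (s - 1) u + (s^-1 - 1) v with u and v between 0 and y - x. One of the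
    corrections is nonnegative, whichever side of 1 contains s; bounding the other leaves at least s
    (y - x) or s^-1 (y - x). *)
Lemma swap_lt a p s : 0 <= p -> 0 < s -> {homo swap a p s : x y / x < y}.
Proof.
move=> p0 s0 x y xy; have sp0 : 0 <= s * p by rewrite mulr_ge0// ltW.
have /andP[u0 u1] := @clamp_le p (x - a) (y - a) p0 ltac:(lra).
have /andP[v0 v1] := @clamp_le (s * p) (x - a - p) (y - a - p) sp0 ltac:(lra).
rewrite /swap -subr_gt0.
set u := clamp p (y - a) - _ in u0 u1; set v := clamp (s * p) (y - a - p) - _ in v0 v1.
rewrite (_ : _ - _ = (y - x) + (s - 1) * u + (s^-1 - 1) * v); last first.
  by rewrite /u /v; ring.
have si0 : 0 < s^-1 by rewrite invr_gt0.
have [s1|s1] := leP s 1.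
  have : 1 <= s^-1 by rewrite invf_ge1.
  move=> si1; have : 0 <= (s^-1 - 1) * v by rewrite mulr_ge0// subr_ge0.
  have : 0 < s * (y - x) by rewrite mulr_gt0// subr_gt0.
  have : 0 <= (1 - s) * (y - x - u) by rewrite mulr_ge0//; lra.
  lra.
have si1 : s^-1 <= 1 by rewrite invf_le1// ltW.
have : 0 <= (s - 1) * u by rewrite mulr_ge0//; lra.
have : 0 < s^-1 * (y - x) by rewrite mulr_gt0// subr_gt0.
have : 0 <= (1 - s^-1) * (y - x - v) by rewrite mulr_ge0//; lra.
lra.
Qed.

(** One-sided so as to include the breakpoints, where [swap_derive1] needs a slope too. *)
Lemma swap_affine_right a p s x : 0 <= p -> 0 < s ->
  exists2 c, (c \in [:: 1; s; s^-1]) & exists2 e, (0 < e) &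
    forall y, x <= y -> y < x + e -> swap a p s y = swap a p s x + c * (y - x).
Proof.
move=> p0 s0; have s0' : s != 0 by rewrite gt_eqF.
have sp0 : 0 <= s * p by rewrite mulr_ge0// ltW.
have [xa|ax] := ltP x a.
  exists 1; rewrite ?in_cons ?eqxx// ; exists (a - x) => [|y xy ya]; first by lra.
  by rewrite !swap_left//; lra.
have [xp|px] := ltP x (a + p).
  exists s; rewrite ?in_cons ?eqxx ?orbT//; exists (a + p - x) => [|y xy ya]; first lra.
  by rewrite !swap_fst//; lra.
have [xp|px'] := ltP x (a + p + s * p).
  exists s^-1; rewrite ?in_cons ?eqxx ?orbT//.
  exists (a + p + s * p - x) => [|y xy ya]; first lra.
  by rewrite !swap_snd//; [field|lra..].
exists 1; rewrite ?in_cons ?eqxx//; exists 1 => // y xy ya.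
by rewrite !swap_right//; lra.
Qed.

Lemma swap_affine_local a p s x : 0 <= p -> 0 < s ->
  x \notin [:: a; a + p; a + p + s * p] ->
  exists c e u v, (x \in `]u, v[) /\
    (forall y, y \in `]u, v[ -> swap a p s y = c * y + e).
Proof.
move=> p0 s0; have s0' : s != 0 by rewrite gt_eqF.
have sp0 : 0 <= s * p by rewrite mulr_ge0// ltW.
rewrite !in_cons !negb_or in_nil => /and4P[x1 x2 x3 _].
have [xa|ax] := ltP x a.
  exists 1, 0, (x - 1), a; split; first by rewrite in_itv/=; lra.
  by move=> y; rewrite in_itv/= => yP; rewrite swap_left//; lra.
have {}ax : a < x by rewrite lt_neqAle eq_sym x1.
have [xp|px] := ltP x (a + p).
  exists s, (a - s * a), a, (a + p); split; first by rewrite in_itv/=; lra.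
  by move=> y; rewrite in_itv/= => yP; rewrite swap_fst//; [ring|lra..].
have {}px : a + p < x by rewrite lt_neqAle eq_sym x2.
have [xp|px'] := ltP x (a + p + s * p).
  exists s^-1, (a + s * p - (a + p) / s), (a + p), (a + p + s * p).
  split; first by rewrite in_itv/=; lra.
  by move=> y; rewrite in_itv/= => yP; rewrite swap_snd//; [field|lra..].
have {}px' : a + p + s * p < x by rewrite lt_neqAle eq_sym x3.
exists 1, 0, (a + p + s * p), (x + 1); split; first by rewrite in_itv/=; lra.
by move=> y; rewrite in_itv/= => yP; rewrite swap_right//; lra.
Qed.

Lemma swap_piecewise_linear (r : nat) a p s : 0 <= p -> 0 < s ->
  piecewise_linear r (swap a p s).
Proof.
move=> p0 s0; have s0' : s != 0 by rewrite gt_eqF.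
have sp0 : 0 <= s * p by rewrite mulr_ge0// ltW.
exists [:: a; a + p; a + p + s * p] => u v _ uv _ bp.
(* An interval free of breakpoints lies on one side of each of them, hence within one of the four
   affine pieces. *)
have out x : x \in [:: a; a + p; a + p + s * p] -> x <= u \/ v <= x.
  move=> /bp; rewrite in_itv/= negb_and -!leNgt => /orP[]; [by left|by right].
have [|ua|va] := out a; first by rewrite mem_head.
have [|up|vp] := out (a + p); first by rewrite !in_cons eqxx orbT.
have [|usp|vsp] := out (a + p + s * p); first by rewrite !in_cons eqxx !orbT.
- exists 1, 0 => x; rewrite in_itv/= => xP.
  by rewrite swap_right//; lra.
- exists s^-1, (a + s * p - (a + p) / s) => x; rewrite in_itv/= => xP.
  by rewrite swap_snd//; [field|lra..].
- exists s, (a - s * a) => x; rewrite in_itv/= => xP.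
  by rewrite swap_fst//; [ring|lra..].
- exists 1, 0 => x; rewrite in_itv/= => xP.
  by rewrite swap_left//; lra.
Qed.

Lemma swap_derivable a p s x : 0 <= p -> 0 < s ->
  x \notin [:: a; a + p; a + p + s * p] -> derivable (swap a p s) x 1.
Proof.
move=> p0 s0 xbp; have [c [e [u [v [xuv H]]]]] := swap_affine_local p0 s0 xbp.
apply: (@near_eq_derivable _ _ _ (fun y => c * y + e)).
  by near=> y; rewrite H//; near: y; exact: near_in_itvoo.
by apply: derivableD => //; apply: derivableM.
Unshelve. all: by end_near. Qed.

(** Where the derivative exists it equals the right-hand slope. This also covers breakpoints at
    which the map is differentiable, as when s = 1 or p = 0. *)
Lemma swap_derive1 a p s x : 0 <= p -> 0 < s -> derivable (swap a p s) x 1 ->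
  derive1 (swap a p s) x \in [:: 1; s; s^-1].
Proof.
move=> p0 s0 dx; have [c cs [e e0 H]] := swap_affine_right a x p0 s0.
suff -> : derive1 (swap a p s) x = c by [].
have : (h^-1 *: (swap a p s (h + x) - swap a p s x)) @[h --> 0^'] --> derive1 (swap a p s) x.
  rewrite /derive1; have := dx; rewrite /derivable.
  set d1 := (fun h => _ *: _); set d2 := (fun h => _ *: _).
  by have -> : d1 = d2 by apply/funext => h; rewrite /d1 /d2 /= [h%:A]mulr1.
move=> /cvg_dnbhs_at_right d1.
have : (h^-1 *: (swap a p s (h + x) - swap a p s x)) @[h --> 0^'+] --> c.
  apply: cvg_near_cst; near=> h.
  have h0 : 0 < h by near: h; exact: nbhs_right_gt.
  have he : h < e by near: h; exact: nbhs_right_lt.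
  rewrite H; [|lra..].
  rewrite addrK (addrC (swap _ _ _ x)) addrK -[LHS]/(h^-1 * (c * h)).
  by field; rewrite gt_eqF.
exact: cvg_unique.
Unshelve. all: by end_near. Qed.

Lemma swap_id a p s (r : R) x : 0 <= a -> 0 <= p -> 0 < s -> a + p + s * p <= r ->
  (x <= 0) || (r <= x) -> swap a p s x = x.
Proof.
move=> a0 p0 s0 pr /orP[x0|rx]; first by rewrite swap_left//; lra.
by rewrite swap_right//; lra.
Qed.

Lemma swap_homo_cc a p s (r : R) : 0 <= a -> 0 <= p -> 0 < s -> a + p + s * p <= r ->
  {homo swap a p s : x / x \in `[0, r]}.
Proof.
move=> a0 p0 s0 pr x; rewrite !in_itv/= => /andP[x0 xr].
have sp0 : 0 <= s * p by rewrite mulr_ge0// ltW.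
have le y z : y <= z -> swap a p s y <= swap a p s z.
  by rewrite le_eqVlt => /predU1P[->//|/(swap_lt a p0 s0)/ltW].
rewrite -[X in X <= _](@swap_id a p s r 0) ?lexx//.
rewrite -[X in _ && (_ <= X)](@swap_id a p s r r) ?lexx ?orbT//.
by rewrite !le.
Qed.

Lemma swap_homo_co a p s (r : R) : 0 <= a -> 0 <= p -> 0 < s -> a + p + s * p <= r ->
  {homo swap a p s : x / x \in `[0, r[}.
Proof.
move=> a0 p0 s0 pr x; rewrite !in_itv/= => /andP[x0 xr].
have /(_ x) := @swap_homo_cc a p s r a0 p0 s0 pr.
rewrite !in_itv/= x0 (ltW xr) => /(_ isT)/andP[-> _] /=.
rewrite -[X in (_ < X)](@swap_id a p s r r) ?lexx ?orbT//.
exact: swap_lt.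
Qed.

End swap.

(** * Swaps with n-adic data belong to both groups *)

Section swap_thompson.
Context (R : realType) (n r : nat) (n_gt1 : (1 < n)%N).
Variables (a p : R) (k : int).
Let s : R := n%:R ^ k.
Hypotheses (a0 : 0 <= a) (p0 : 0 <= p) (pr : a + p + s * p <= r%:R).
Hypotheses (za : Zinv n a) (zp : Zinv n p).

Let n_gt0 : 0 < n%:R :> R. Proof. by rewrite ltr0n ltnW. Qed.
Let s0 : 0 < s. Proof. exact: exprz_gt0. Qed.
Let sp0 : 0 <= s * p. Proof. by rewrite mulr_ge0// ltW. Qed.
Let si0 : 0 < s^-1. Proof. by rewrite invr_gt0. Qed.
Let sK : s^-1 * (s * p) = p. Proof. by rewrite mulKf// gt_eqF. Qed.
Let pr' : a + s * p + s^-1 * (s * p) <= r%:R. Proof. by rewrite sK addrAC. Qed.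
Let zs : Zinv n s. Proof. exact: Zinv_exp. Qed.
Let zsV : Zinv n s^-1. Proof. by rewrite /s invr_expz; exact: Zinv_exp. Qed.

Let adic_swap : adic_singularities n r (swap a p s) /\ adic_slopes n r (swap a p s).
Proof.
split=> x _.
  move=> nd; have [|/(swap_derivable p0 s0)//] :=
    boolP (x \in [:: a; a + p; a + p + s * p]).
  rewrite !in_cons in_nil orbF => /or3P[] /eqP ->//.
    exact: ZinvD.
  by apply: ZinvD => //; [exact: ZinvD|exact: ZinvM].
move=> /(swap_derive1 p0 s0); rewrite !in_cons in_nil orbF => /or3P[] /eqP ->.
- by exists 0; rewrite expr0z.
- by exists k.
- by exists (- k); rewrite invr_expz.
Qed.

Lemma swap_in_F : in_F n r (swap a p s).
Proof.
split.
- move=> x; rewrite inE/= in_itv/= negb_and -!ltNge => xr.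
  by apply: (swap_id (r := r%:R)) => //; case/orP : xr => /ltW ->; rewrite ?orbT.
- exists (swap a (s * p) s^-1); split.
  + exact: swap_homo_cc.
  + exact: swap_homo_cc.
  + by move=> x _; exact: swapK.
  + by move=> x _; exact: swapVK.
  + by split; apply: continuous_subspaceT; exact: continuous_swap.
- by move=> x y _ _; exact: swap_lt.
- exact: swap_piecewise_linear.
- exact: adic_swap.
Qed.

Lemma swap_in_G : in_G n r (swap a p s).
Proof.
split.
- move=> x; rewrite inE/= in_itv/= negb_and -leNgt -ltNge => xr.
  apply: (swap_id (r := r%:R)) => //.
  by case/orP : xr => [/ltW|] ->; rewrite ?orbT.
- split.
  + by move=> x; exact: swap_homo_co.
  + by move=> x y _ _; exact: (can_inj (swapK a p0 s0)).
  + move=> y yI; exists (swap a (s * p) s^-1 y); last exact: swapVK.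
    exact: swap_homo_co.
- by move=> x _; apply: cvg_at_right_filter; exact: continuous_swap.
- exact: swap_piecewise_linear.
- have [? ?] := adic_swap; split => //; split => // x _ zx.
  have zsp := ZinvM zs zp.
  have [xa|ax] := leP x a; first by rewrite swap_left.
  have [x1|x1] := leP x (a + p).
    rewrite swap_fst ?(ltW ax)//; apply: ZinvD => //; apply: ZinvM => //.
    exact: ZinvB.
  have [x2|x2] := leP x (a + p + s * p); last by rewrite swap_right// ltW.
  rewrite swap_snd ?(ltW x1)//; apply: ZinvD => //; first exact: ZinvD.
  by apply: ZinvM => //; apply: ZinvB => //; exact: ZinvB.
Qed.

End swap_thompson.

(** * Koopman operators of swaps *)

Section lambda_swap.
Context (R : realType) (r : nat) (r_gt0 : (0 < r)%N).
Local Notation leb := (@lebesgue_measure R).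
Local Notation Rm := (measurableTypeR R).
Local Notation mu := (lambda R r_gt0).

(** By uniqueness of Lebesgue measure: c times the image of [leb] under the affine map agrees with
    [leb] on half-open intervals. *)
Lemma lebesgue_measure_affine (c e : R) (A : set Rm) : 0 < c -> measurable A ->
  leb [set x | A (c * x + e)] = (c^-1%:E * leb A)%E.
Proof.
move=> c0 mA; pose h : Rm -> Rm := fun x => c * x + e.
have mh : measurable_fun setT h.
  by apply: measurable_funD => //; exact: measurable_funM.
pose c' : {nonneg R} := NngNum (ltW c0).
pose nu := mscale c' (measure_function_pushforward__canonical__measure_function_Measure
  leb mh).
suff -> : leb A = nu A.
  by rewrite /nu /mscale/= muleA -EFinM mulVf ?gt_eqF// mul1e.
apply: lebesgue_measure_unique => // _ [[u v]] _ <-.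
rewrite -[RHS]/(c%:E * leb (h @^-1` `]u, v]%classic))%E.
have -> : h @^-1` `]u, v]%classic = `](u - e) / c, (v - e) / c]%classic.
  apply/seteqP; split => x; rewrite /= !in_itv /= /h;
    by rewrite ltr_pdivrMr// ler_pdivlMr// ltrBlDr lerBrDr mulrC.
rewrite !lebesgue_measure_itv/= !lte_fin ltr_pM2r ?invr_gt0// ltrD2r.
case: ifP => _; last by rewrite mule0.
by rewrite -!EFinD -EFinM; congr EFin; field; rewrite gt_eqF.
Qed.

Lemma lambda_inside : {ae mu, forall x, 0 < x < r%:R}.
Proof.
pose N : set Rm := [set x | ~ (0 < x < r%:R)].
have mN : measurable N.
  have -> : N = ~` `]0, r%:R[%classic.
    by apply/seteqP; split => x; rewrite /N/= in_itv.
  by apply: measurableC; exact: measurable_itv.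
exists N; split => //; rewrite lambdaE//.
suff -> : leb (N `&` `[0, r%:R]%classic) = 0%E by rewrite mule0.
apply: (@subset_measure0 _ _ _ leb _ ([set 0] `|` [set r%:R] : set Rm)).
- by apply: measurableI => //; exact: measurable_itv.
- by apply: measurableU; exact: measurable_set1.
- move=> x [/= Nx]; rewrite in_itv/= => /andP[x0 xr].
  have [->|x0'] := eqVneq x 0; first by left.
  right; apply/eqP; rewrite eq_le xr leNgt; apply/negP => xr'; apply: Nx.
  by rewrite lt_neqAle eq_sym x0' x0.
- apply: countable_lebesgue_measure0; apply: finite_set_countable.
  by rewrite finite_setU; split; exact: finite_set1.
Qed.

Lemma lambda_ae_le (P : set R) : {ae leb, forall x, P x} -> {ae mu, forall x, P x}.
Proof.
move=> [N [mN N0 PN]]; exists N; split => //.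
rewrite lambdaE// (@subset_measure0 _ _ _ _ _ N) ?mule0//.
by apply: measurableI => //; exact: measurable_itv.
Qed.

Lemma lambda_neq (y : R) : {ae mu, forall x, x != y}.
Proof.
apply: lambda_ae_le; exists [set y]; split.
- exact: measurable_set1.
- exact: lebesgue_measure_set1.
- by move=> x /= /negP; rewrite negbK => /eqP.
Qed.

Section swap_density.
Variables (a p s : R) (g : nonsingular mu).
Hypotheses (a0 : 0 <= a) (p0 : 0 <= p) (s0 : 0 < s) (pr : a + p + s * p <= r%:R).
Hypothesis gE : ns_fun g = swap a p s :> (R -> R).

Let sp0 : 0 <= s * p. Proof. by rewrite mulr_ge0// ltW. Qed.
Let si0 : 0 < s^-1. Proof. by rewrite invr_gt0. Qed.
Let sK : s^-1 * (s * p) = p. Proof. by rewrite mulKf// gt_eqF. Qed.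

Lemma ns_inv_swap : ns_inv g = swap a (s * p) s^-1 :> (R -> R).
Proof.
apply/funext => x; rewrite -[RHS](ns_funK g).
by congr (ns_inv g _); rewrite gE swapVK.
Qed.

Let mono_swap x : (swap a p s x \in `[0, r%:R]) = (x \in `[0, r%:R]).
Proof.
apply/idP/idP => xI; last exact: swap_homo_cc.
rewrite -(swapK a p0 s0 x); apply: swap_homo_cc => //.
by rewrite sK addrAC.
Qed.

(** For B inside A, the preimage of B under the swap is its image under x -> c x + e, hence has
    measure c times that of B; [density_eq] concludes. The restriction to [0, r] is harmless since
    the swap preserves that interval. *)
Lemma swap_density (A : set Rm) (c e : R) : measurable A -> 0 < c ->
  (forall x, A x -> swap a (s * p) s^-1 x = c * x + e) ->
  {ae mu, forall x, A x -> transported_density g x = c}.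
Proof.
move=> mA c0 HA; apply: density_eq => // B BA mB.
have mpre : measurable (ns_fun g @^-1` B).
  by rewrite -[X in measurable X]setTI; exact: measurable_funP.
rewrite !lambdaE// muleCA; congr (_ * _)%E.
have mB' : measurable (B `&` `[0, r%:R]%classic).
  by apply: measurableI => //; exact: measurable_itv.
rewrite -[c in RHS]invrK -(@lebesgue_measure_affine c^-1 (- e / c)) ?invr_gt0//.
congr (leb _); apply/seteqP; split => x /=.
  rewrite gE => -[Bx xI].
  rewrite (_ : c^-1 * x + - e / c = swap a p s x).
    by split => //; rewrite mono_swap.
  by rewrite -[in LHS](swapK a p0 s0 x) HA; [field; rewrite gt_eqF|exact: BA].
move=> [Bx xI]; have := HA _ (BA _ Bx).
rewrite (_ : c * _ + e = x); last by field; rewrite gt_eqF.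
move=> xE; have xE' : c^-1 * x + - e / c = swap a p s x by rewrite -[in RHS]xE swapVK.
by move: Bx xI; rewrite xE' gE mono_swap.
Qed.

Lemma koopman_swap (A : set Rm) (c e : R) : measurable A -> 0 < c ->
  (forall x, A x -> swap a (s * p) s^-1 x = c * x + e) ->
  forall f, {ae mu, forall x, A x ->
    koopman g f x = (Num.sqrt c)%:C * f (swap a (s * p) s^-1 x)}.
Proof.
move=> mA c0 HA f; apply: filterS (swap_density mA c0 HA) => x H /H dE.
by rewrite /koopman dE ns_inv_swap.
Qed.

End swap_density.
End lambda_swap.

(** * Lebesgue points in quadratic mean *)

Lemma aeS3 d (T : measurableType d) (R : realType)
    (mu : {measure set T -> \bar R}) (P Q S W : set T) :
  (forall x, P x -> Q x -> S x -> W x) -> {ae mu, forall x, P x} ->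
  {ae mu, forall x, Q x} -> {ae mu, forall x, S x} -> {ae mu, forall x, W x}.
Proof. by move=> PQSW; apply: filterS3. Qed.

Section L2_lebesgue_point.
Context (R : realType) (r : nat) (r_gt0 : (0 < r)%N).
Local Notation leb := (@lebesgue_measure R).
Local Notation Rm := (measurableTypeR R).
Local Notation mu := (lambda R r_gt0).
Local Notation I := (`[0, r%:R]%classic : set Rm).

Let mI : measurable I. Proof. exact: measurable_itv. Qed.

Lemma energy_lambda (f : Rm -> R[i]) : cmeas f ->
  energy mu f = ((r%:R)^-1%:E * \int[leb]_(x in I) (sqc (f x))%:E)%E.
Proof.
move=> mf; rewrite /energy /lambda integral_uniform//=.
- by rewrite subr0.
- exact: measurable_sqcE.
- by move=> x; rewrite lee_fin sqc_ge0.
Qed.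

Lemma integrable_lebesgue_sqc (f : Rm -> R[i]) : cmeas f ->
  (energy mu f < +oo)%E -> leb.-integrable I (fun x => (sqc (f x))%:E).
Proof.
move=> mf foo; apply/integrableP; split.
  by apply: measurable_funTS; exact: measurable_sqcE.
have -> : (\int[leb]_(x in I) `|(sqc (f x))%:E| = r%:R%:E * energy mu f)%E.
  rewrite energy_lambda// muleA -EFinM mulfV ?pnatr_eq0 ?gtn_eqF// mul1e.
  by apply: eq_integral => x _; rewrite gee0_abs// lee_fin sqc_ge0.
rewrite ltey_eq fin_numM//.
by rewrite ge0_fin_numE ?energy_ge0.
Qed.

(** The bound 1 + |f|^2 covers Re f, Im f and |f|^2 at once; the constant is integrable because
    [0, r] has finite measure. *)
Lemma integrable_lebesgue_le (f : Rm -> R[i]) (g : Rm -> R) : cmeas f ->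
  (energy mu f < +oo)%E -> measurable_fun setT g ->
  (forall x, `|g x| <= 1 + sqc (f x)) -> (forall x, ~ I x -> g x = 0) ->
  locally_integrable setT g.
Proof.
move=> mf foo mg gf gI; apply: open_integrable_locally; first exact: openT.
have -> : EFin \o g = (EFin \o g) \_ I.
  apply/funext => x; rewrite patchE; case: ifPn => //.
  by rewrite notin_setE => /gI /= ->.
apply/(integrable_mkcond _ mI).1.
apply: (@le_integrable _ _ _ leb _ mI _ (fun x => 1%:E + (sqc (f x))%:E)%E).
- by apply/measurable_EFinP; exact: measurable_funTS.
- move=> x _ /=; rewrite lee_fin (le_trans (gf x))//.
  by rewrite ler_norm.
- apply: integrableD => //; last exact: integrable_lebesgue_sqc.
  apply/integrableP; split; first exact: measurable_cst.
  rewrite integral_cst//= normr1 mul1e lebesgue_measure_itv/=.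
  by case: ifP => _; rewrite ltry.
Qed.

Lemma davg_lt (g : R -> R) (x rho eta : R) : 0 < rho ->
  (davg g x rho < eta%:E)%E ->
  (\int[leb]_(y in ball x rho) `|g y - g x|%:E <= (eta * (rho *+ 2))%:E)%E.
Proof.
move=> rho0; rewrite /davg /iavg lebesgue_measure_ball; last exact: ltW.
have r2 : 0 < rho *+ 2 by rewrite mulrn_wgt0.
rewrite inver gt_eqF//=.
set J := (\int[_]_(_ in _) _)%E.
have : (0 <= J)%E by apply: integral_ge0 => y _; rewrite lee_fin.
case: J => [j| |]//.
  by rewrite -EFinM !lee_fin lte_fin mulrC ltr_pdivrMr// => _ /ltW.
by rewrite gt0_muley ?lte_fin ?invr_gt0.
Qed.

(** Expanding the square bounds |f y - f x|^2 by the deviations at x of |f|^2, Re f and Im f. These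
    three functions are locally integrable, so the usual differentiation theorem applies to each. *)
Lemma L2_lebesgue_pt (f : Rm -> R[i]) : cmeas f -> (energy mu f < +oo)%E ->
  (forall x, ~ I x -> f x = 0) ->
  {ae leb, forall x, forall e, 0 < e -> \forall rho \near 0^'+,
    (\int[leb]_(y in ball x rho) (sqc (f y - f x))%:E <= (e * rho)%:E)%E}.
Proof.
move=> mf foo fI; have [mr mi] := mf.
have sqr_le (t : R) : `|t| <= 1 + t ^+ 2.
  have -> : t ^+ 2 = `|t| ^+ 2 by rewrite -normrX ger0_norm ?sqr_ge0.
  have := sqr_ge0 (`|t| - 1); have := normr_ge0 t; nra.
have Lr : {ae leb, forall x, lebesgue_pt (fun x => complex.Re (f x)) x}.
  apply: lebesgue_differentiation; apply: (integrable_lebesgue_le mf) => //.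
    by move=> x; rewrite (le_trans (sqr_le _))// lerD2l lerDl sqr_ge0.
  by move=> x /fI ->.
have Li : {ae leb, forall x, lebesgue_pt (fun x => complex.Im (f x)) x}.
  apply: lebesgue_differentiation; apply: (integrable_lebesgue_le mf) => //.
    by move=> x; rewrite (le_trans (sqr_le _))// lerD2l lerDr sqr_ge0.
  by move=> x /fI ->.
have Ls : {ae leb, forall x, lebesgue_pt (fun x => sqc (f x)) x}.
  apply: lebesgue_differentiation; apply: (integrable_lebesgue_le mf) => //.
  - exact: measurable_sqc.
  - by move=> x; rewrite ger0_norm ?sqc_ge0// lerDr.
  - by move=> x /fI ->; rewrite sqc0.
apply: aeS3 Lr Li Ls => x Lr Li Ls e e0.
set a := complex.Re (f x); set b := complex.Im (f x).
have k0 : 0 < 1 + 2 * `|a| + 2 * `|b|.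
  by have := normr_ge0 a; have := normr_ge0 b; lra.
(* The three averages enter with weights 1, 2 |a| and 2 |b|, and the ball has length 2 rho: the
   total is exactly e rho. *)
pose eta := e / 2 / (1 + 2 * `|a| + 2 * `|b|).
have eta0 : 0 < eta by rewrite !divr_gt0.
have small (g : R -> R) : lebesgue_pt g x ->
    \forall rho \near 0^'+, (davg g x rho < eta%:E)%E.
  move=> Lg; apply: (Lg [set y | (y < eta%:E)%E]); apply: open_nbhs_nbhs.
  by split; [exact: open_ereal_lt_ereal|rewrite /= lte_fin].
near=> rho.
have rho0 : 0 < rho by near: rho; exact: nbhs_right_gt.
have mB : measurable (ball x rho : set Rm) by exact: measurable_ball.
have /(davg_lt rho0) Hr : (davg (fun x => complex.Re (f x)) x rho < eta%:E)%E.
  by near: rho; exact: small.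
have /(davg_lt rho0) Hi : (davg (fun x => complex.Im (f x)) x rho < eta%:E)%E.
  by near: rho; exact: small.
have /(davg_lt rho0) Hs : (davg (fun x => sqc (f x)) x rho < eta%:E)%E.
  by near: rho; exact: small.
have mabs (g : R -> R) c : measurable_fun (setT : set Rm) g ->
    measurable_fun (ball x rho : set Rm) (fun y => `|g y - c|%:E).
  move=> mg; apply/measurable_EFinP; apply: measurable_funTS.
  apply: measurableT_comp => //; exact: measurable_funB.
have mrx := mabs _ a mr; have mix := mabs _ b mi.
have msx := mabs _ (sqc (f x)) (measurable_sqc mf).
apply: (@le_trans _ _ (\int[leb]_(y in ball x rho) (`|sqc (f y) - sqc (f x)|%:E +
    ((2 * `|a|)%:E * `|complex.Re (f y) - a|%:E + (2 * `|b|)%:E * `|complex.Im (f y) - b|%:E)))%E).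
  apply: ge0_le_integral => //.
  - by move=> y _; rewrite lee_fin sqc_ge0.
  - apply: measurable_funTS; apply: measurable_sqcE; apply: cmeasB => //.
  - apply: emeasurable_funD => //.
    by apply: emeasurable_funD; exact: measurable_funeM.
  - move=> y _; rewrite -!EFinM -!EFinD lee_fin.
    (* |w - z|^2 = (|w|^2 - |z|^2) - 2 Re (conj z * (w - z)) *)
    have -> : sqc (f y - f x) = (sqc (f y) - sqc (f x)) -
        (2 * a * (complex.Re (f y) - a) + 2 * b * (complex.Im (f y) - b)).
      rewrite /a /b; case: (f y) (f x) => [? ?] [? ?]; rewrite /sqc/=; ring.
    have := ler_norm (sqc (f y) - sqc (f x)).
    have := ler_norm (- (2 * a * (complex.Re (f y) - a))).
    have := ler_norm (- (2 * b * (complex.Im (f y) - b))).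
    rewrite !normrN !normrM !(ger0_norm (ler0n R 2)); lra.
rewrite ge0_integralD//; last 2 first.
- by move=> y _; rewrite -!EFinM -!EFinD lee_fin addr_ge0// !mulr_ge0.
- by apply: emeasurable_funD; exact: measurable_funeM.
rewrite ge0_integralD//; try exact: measurable_funeM.
rewrite !ge0_integralZl//; try by rewrite lee_fin mulr_ge0.
apply: (@le_trans _ _ ((eta * (rho *+ 2))%:E + ((2 * `|a|)%:E * (eta * (rho *+ 2))%:E +
   (2 * `|b|)%:E * (eta * (rho *+ 2))%:E))%E).
  by apply: leeD => //; apply: leeD; apply: lee_wpmul2l; rewrite ?lee_fin ?mulr_ge0.
rewrite -!EFinM -!EFinD lee_fin le_eqVlt; apply/orP; left; apply/eqP.
by rewrite /eta; field; rewrite gt_eqF.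
Unshelve. all: by end_near. Qed.

End L2_lebesgue_point.

(** * Negative powers of n and density of Z[1/n] *)

Section powers.
Context (R : realType) (n : nat) (n_gt1 : (1 < n)%N).

Lemma expNn_gt0 (k : nat) : 0 < n%:R ^- k :> R.
Proof. by rewrite invr_gt0 exprn_gt0// ltr0n ltnW. Qed.

Lemma expNn_le1 (k : nat) : n%:R ^- k <= 1 :> R.
Proof. by rewrite invf_le1 ?exprn_ege1 ?exprn_gt0 ?ltr0n ?ler1n// ltnW. Qed.

Lemma near_expNn_lt (e : R) : 0 < e -> \forall k \near \oo, n%:R ^- k < e.
Proof.
move=> e0; have : (n%:R^-1 : R) ^+ k @[k --> \oo] --> (0 : R).
  apply: cvg_expr; rewrite ger0_norm ?invr_ge0//.
  by rewrite invf_lt1 ?ltr0n ?ltr1n// ltnW.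
move=> /cvgrPdist_lt/(_ e e0); apply: filterS => k; rewrite sub0r normrN ger0_norm.
  by rewrite exprVn.
by rewrite exprn_ge0// invr_ge0.
Qed.

Lemma Zinv_expNn (k : nat) : Zinv n (n%:R ^- k : R).
Proof. by exists 1, k; rewrite mul1r. Qed.

Lemma Zinv_between (k : nat) (x : R) :
  exists p, [/\ Zinv n p, x < p & p <= x + n%:R ^- k].
Proof.
have s0 := expNn_gt0 k; set s : R := n%:R ^- k in s0 *.
(* Rounding up to the grid n^-k Z; floor plus one, not a ceiling, gives the strict inequality. *)
exists ((Num.floor (x / s) + 1)%:~R * s); split.
- apply: ZinvM => //; [exact: Zinv_int|exact: Zinv_expNn].
- by rewrite -ltr_pdivrMr//; exact: floorD1_gt.
- rewrite intrD mulrDl mul1r lerD2r -ler_pdivlMr//.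
  exact: floor_le.
Qed.

End powers.

(** * Closed subspaces invariant under all swaps *)

Section irreducibility.
Context (R : realType) (n r : nat) (n_gt1 : (1 < n)%N) (r_gt0 : (0 < r)%N).
Local Notation leb := (@lebesgue_measure R).
Local Notation Rm := (measurableTypeR R).
Local Notation mu := (lambda R r_gt0).
Context (V : set (Rm -> R[i])) (cV : closed_subspace mu V).
(** All that is kept of the group, so that F and G are treated together. *)
Hypothesis Vswap : forall (a p : R) (k : int), 0 <= a -> 0 <= p ->
  a + p + n%:R ^ k * p <= r%:R -> Zinv n a -> Zinv n p ->
  exists2 g : nonsingular mu, ns_fun g = swap a p (n%:R ^ k) :> (R -> R) &
    forall f, V f -> V (koopman g f).

Let r1 : 1 <= r%:R :> R. Proof. by rewrite ler1n. Qed.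

(** * Stability under multiplication by indicators *)

Lemma koopmanD (g : nonsingular mu) f1 f2 x :
  koopman g (fun x => f1 x + f2 x) x = koopman g f1 x + koopman g f2 x.
Proof. by rewrite /koopman mulrDr. Qed.

Lemma halfC (z : R[i]) : (2^-1)%:C * (z + z) = z.
Proof.
by case: z => a b; apply/eqP; rewrite eq_complex/=; apply/andP; split; apply/eqP; field.
Qed.

(** The compact intervals [K k] exhaust ]0, q[, so the part of f on the remaining set [A k] has
    energy tending to 0; c0 is the part on [K k], e0 the part on [A k]. *)
Lemma cutoff_split f (q : R) : cmeas f -> (energy mu f < +oo)%E -> 0 < q ->
  forall e, 0 < e -> exists c0 e0 u v, [/\ cmeas c0, cmeas e0,
    [/\ 0 < u, u <= v & v < q],
    (forall x, c0 x != 0 -> u <= x <= v) &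
    [/\ (energy mu c0 <= energy mu f)%E, (energy mu e0 <= e%:E)%E &
     f = (fun x => cutoff `]q, +oo[%classic f x + c0 x + e0 x)]].
Proof.
move=> mf foo q0 e e0.
(* The offset 2 gives d k <= q / 2, so that [d k, q - d k] is never empty. *)
pose d (k : nat) : R := q * k.+2%:R^-1.
pose K k : set Rm := `[d k, q - d k]%classic.
pose A k : set Rm := `]-oo, q]%classic `\` K k.
have mA k : measurable (A k) by apply: measurableD; exact: measurable_itv.
have A0 : {ae mu, forall x, \forall k \near \oo, ~ A k x}.
  apply: aeS2 (lambda_inside R r_gt0) (lambda_neq r_gt0 q).
  move=> x /andP[x0 xr] xq.
  pose m := Num.min x `|q - x| / q.
  have m0 : 0 < m.
    by rewrite divr_gt0// lt_min x0 normr_gt0 subr_eq0 eq_sym.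
  have := near_infty_natSinv_lt (PosNum m0); apply: filterS => k /= km.
  have dm : d k < Num.min x `|q - x|.
    rewrite /d mulrC -ltr_pdivlMr//; apply: le_lt_trans km.
    by rewrite lef_pV2 ?posrE// ler_nat.
  move=> [/= xq' ]; apply; rewrite /K/= in_itv/=; move: dm; rewrite lt_min => /andP[xd].
  rewrite in_itv/= in xq'; rewrite ger0_norm ?subr_ge0//; lra.
have [k _ /(_ k (leqnn k)) ke] := cvge0_lt (energy_cutoff_cvg0 mf foo mA A0) e0.
have k2 : 0 < k.+2%:R^-1 :> R by [].
have k2' : k.+2%:R^-1 <= 2^-1 :> R by rewrite lef_pV2 ?posrE// ler_nat.
have dk0 : 0 < d k by rewrite /d mulr_gt0.
have dkq : d k <= q * 2^-1 by rewrite /d ler_pM2l.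
exists (cutoff (K k) f), (cutoff (A k) f), (d k), (q - d k); split.
- by apply: cmeas_cutoff => //; exact: measurable_itv.
- exact: cmeas_cutoff.
- by split => //; lra.
- move=> x; have [|nKx] := pselect (K k x); first by rewrite /K/= in_itv.
  by rewrite cutoff_out// eqxx.
- split; last 1 first.
  + apply/funext => x; have [xq|xq] := ltP q x.
      rewrite cutoff_in/= ?in_itv/= ?xq// !cutoff_out ?addr0//.
        by rewrite /A/= in_itv/= => -[]; rewrite leNgt xq.
      by rewrite /K/= in_itv/=; lra.
    rewrite cutoff_out/= ?in_itv/= ?andbT ?ltNge ?xq// add0r.
    have [Kx|nKx] := pselect (K k x).
      by rewrite cutoff_in// cutoff_out ?addr0//; case.
    by rewrite cutoff_out// cutoff_in ?add0r//; split => //=; rewrite in_itv.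
  + apply: energy_le => //; last by move=> x; exact: sqc_cutoff_le.
    by apply: cmeas_cutoff => //; exact: measurable_itv.
  + exact: ltW.
Qed.

(** Induction on m. A swap inside [0, q] pushes the support [u, v] of c0 to the left of u. Averaging
    with the image then halves the energy of c0 by disjointness, does not increase that of e0 by
    convexity, and keeps the part beyond q. The support of the new c0 is again compact in ]0, q[,
    which lets the induction go on. *)
Lemma koopman_halving f (q : R) : V f -> 0 < q -> q <= r%:R ->
  forall (m : nat) e, 0 < e -> exists c0 e0 u v, [/\ cmeas c0, cmeas e0,
    [/\ 0 < u, u <= v & v < q],
    (forall x, c0 x != 0 -> u <= x <= v) &
    [/\ (energy mu c0 <= (2^-1 ^+ m)%:E * energy mu f)%E,
        (energy mu e0 <= e%:E)%E &
        V (fun x => cutoff `]q, +oo[%classic f x + c0 x + e0 x)]].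
Proof.
move=> Vf q0 qr m e e_gt0.
have mf := csub_cmeas cV Vf; have foo := csub_energy cV Vf.
have mq : measurable (`]q, +oo[%classic : set Rm) by exact: measurable_itv.
set fo := cutoff `]q, +oo[%classic f.
have mfo : cmeas fo by exact: cmeas_cutoff.
elim: m => [|m [c0 [e0 [u [v [mc me [u0 uv vq] c0P [c0E e0E Vc]]]]]]].
  have [c0 [e0 [u [v [mc me uvq c0P [c0E e0E fE]]]]]] :=
    cutoff_split mf foo q0 e_gt0.
  exists c0, e0, u, v; split => //; split => //; first by rewrite expr0 mul1e.
  by rewrite -fE.
have v0 : 0 < v by exact: lt_le_trans uv.
have rk0 : 0 < r%:R * 2 :> R by rewrite mulr_gt0// ltr0n.
(* With s = n^-k, the first bound gives s v < u (disjoint supports); the second, with v < p <= v +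
   s, gives p + s p <= q (swap supported in [0, q]). *)
have d1 : 0 < u / (r%:R * 2) by rewrite divr_gt0.
have d2 : 0 < (q - v) / (r%:R * 2) by rewrite divr_gt0// subr_gt0.
have [k _ /(_ k (leqnn k)) /= [k1 k2]] := filterI
  (near_expNn_lt n_gt1 d1) (near_expNn_lt n_gt1 d2).
have s0 := expNn_gt0 R n_gt1 k; have s1 := expNn_le1 R n_gt1 k.
have [p [zp vp ps]] := Zinv_between n_gt1 k v.
have sE : n%:R ^ (- k%:Z) = n%:R ^- k :> R by rewrite exprnN.
have := @Vswap 0 p (- k%:Z); rewrite sE {sE}.
move: k1 k2 s0 s1 ps; set s : R := n%:R ^- k => k1 k2 s0 s1 ps.
rewrite ltr_pdivlMr// in k1; rewrite ltr_pdivlMr// in k2.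
have sr : s <= s * r%:R by rewrite ler_peMr// ltW.
have pq : p < q by lra.
have p0 : 0 < p by exact: lt_trans vp.
have spr : s * p <= s * r%:R by rewrite ler_pM2l// (le_trans (ltW pq)).
have psq : p + s * p <= q by lra.
have psr : 0 + p + s * p <= r%:R by rewrite add0r (le_trans psq).
move=> /(_ (lexx _) (ltW p0) psr (Zinv_int R n 0) zp)[g gE Vg].
have sp0 : 0 < s * p by rewrite mulr_gt0.
have si0 : 0 < s^-1 by rewrite invr_gt0.
have sK : s^-1 * (s * p) = p by rewrite mulKf// gt_eqF.
have giE := ns_inv_swap (ltW p0) s0 gE.
have giq x : q <= x -> swap 0 (s * p) s^-1 x = x.
  by move=> qx; rewrite swap_right ?(ltW sp0)// sK; lra.
(* Beyond q the swap is the identity, with density 1 a.e.; at x <= q both sides vanish, since the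
   inverse swap keeps such points at most q. *)
have kfo : {ae mu, forall x, koopman g fo x = fo x}.
  apply: aeS (koopman_swap (lexx 0) (ltW p0) s0 psr gE mq ltr01 (e := 0) _ fo) => x; last first.
    by rewrite /= in_itv/= andbT => /ltW/giq ->; rewrite mul1r addr0.
  rewrite /= in_itv/= andbT; have [xq _|qx] := leP x q; last first.
    by move=> /(_ isT) ->; rewrite sqrtr1 mul1r giq ?ltW.
  rewrite /koopman giE /fo !cutoff_out ?mulr0//= in_itv/= andbT; apply/negP; rewrite -leNgt//.
  rewrite -(giq q)//; have [->//|xq'] := eqVneq x q.
  by apply/ltW/swap_lt; rewrite ?(ltW sp0)// lt_neqAle xq'.
(* As v < p, the support of c0 lies where the swap is multiplication by s. *)
have kc0 x : koopman g c0 x != 0 -> s * u <= x <= s * v.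
  rewrite /koopman mulf_eq0 negb_or => /andP[_ /c0P]; rewrite giE.
  have xE := swapVK 0 (ltW p0) s0 x.
  move=> /andP[yu yv]; rewrite -xE swap_fst ?add0r ?subr0 ?ler_pM2l ?yu ?yv//; lra.
have svu : s * v < u.
  by apply: le_lt_trans k1; rewrite ler_pM2l//; lra.
exists (fun x => (2^-1)%:C * (c0 x + koopman g c0 x)),
  (fun x => (2^-1)%:C * (e0 x + koopman g e0 x)), (s * u), v.
have mkc : cmeas (koopman g c0) by exact: cmeas_koopman.
have mke : cmeas (koopman g e0) by exact: cmeas_koopman.
have suu : s * u <= u by rewrite ler_piMl// ltW.
have c0oo : (energy mu c0 < +oo)%E.
  apply: (le_lt_trans c0E); rewrite ltey_eq fin_numM//.
  by rewrite ge0_fin_numE ?energy_ge0.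
have e0oo : (energy mu e0 < +oo)%E by apply: (le_lt_trans e0E); exact: ltry.
split.
- by apply: cmeasZ; exact: cmeasD.
- by apply: cmeasZ; exact: cmeasD.
- by split => //; [rewrite mulr_gt0|lra].
- move=> x; rewrite mulf_eq0 negb_or => /andP[_].
  have [->|/c0P] := eqVneq (c0 x) 0; first by rewrite add0r => /kc0; lra.
  by move=> ? _; lra.
- split.
  + rewrite energy_half_disj//; last first.
      move=> x; have [->|/c0P xuv] := eqVneq (c0 x) 0; first by left.
      right; apply/eqP/negPn/negP => /kc0; lra.
    rewrite energy_koopman//; move: c0E foo (energy_ge0 mu f) (energy_ge0 mu c0) c0oo.
    case: (energy mu f) => [y| |]//; case: (energy mu c0) => [z| |]// + _ _ _ _.
    rewrite -?EFinM -?EFinD -?EFinM !lee_fin exprS => zy.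
    rewrite (_ : 4^-1 * (z + z) = 2^-1 * z); last by field.
    by rewrite -mulrA ler_pM2l.
  + apply: (le_trans (energy_half_le _ me mke)).
    rewrite energy_koopman//; move: e0E (energy_ge0 mu e0) e0oo.
    case: (energy mu e0) => [z| |]// + _ _.
    rewrite -?EFinD -?EFinM !lee_fin => ze.
    by rewrite (_ : 2^-1 * (z + z) = z)//; field.
  + have := csubZ cV (2^-1)%:C (csubD cV Vc (Vg _ Vc)).
    move=> /(csub_ae cV); apply.
      apply: cmeasD; last by apply: cmeasZ; exact: cmeasD.
      by apply: cmeasD => //; apply: cmeasZ; exact: cmeasD.
    apply: aeS kfo => x kx _; rewrite !koopmanD kx.
    by move: (fo x) => z; rewrite -[z in LHS]halfC -!mulrDr; congr (_ * _); ring.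
Qed.

Lemma csub_cutoff_right f (q : R) : V f -> 0 < q -> q <= r%:R ->
  V (cutoff `]q, +oo[%classic f).
Proof.
move=> Vf q0 qr; have mf := csub_cmeas cV Vf; have foo := csub_energy cV Vf.
have mq : measurable (`]q, +oo[%classic : set Rm) by exact: measurable_itv.
have mfo := cmeas_cutoff mf mq.
apply: (csub_lim cV) => // e e_gt0.
have F0 : 0 <= fine (energy mu f) by rewrite fine_ge0// energy_ge0.
(* Both remainders get energy at most e / 8, so their sum has energy at most e / 2. Adding 1 avoids
   a division by zero. *)
have d0 : 0 < e / 8 / (fine (energy mu f) + 1) by rewrite !divr_gt0//; lra.
have [m _ /(_ m (leqnn m))] := @near_expNn_lt R 2 isT _ d0.
rewrite ltr_pdivlMr; last by lra.
move=> me; have e8 : 0 < e / 8 by rewrite divr_gt0.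
have [c0 [e0 [u [v [mc me0 _ _ [c0E e0E Vc]]]]]] := koopman_halving Vf q0 qr m e8.
exists (fun x => cutoff `]q, +oo[%classic f x + c0 x + e0 x) => //.
rewrite (_ : (fun x => _) = (fun x => (-1) * (c0 x + e0 x))); last first.
  by apply/funext => x; ring.
rewrite energyZ; last exact: cmeasD.
rewrite sqcN (_ : sqc 1 = 1 :> R) ?mul1e; last by rewrite /sqc/= expr1n expr0n addr0.
apply: (le_lt_trans (energyD_le mu mc me0)).
move: c0E e0E foo me F0 (energy_ge0 mu f) (energy_ge0 mu c0) (energy_ge0 mu e0).
case: (energy mu c0) => [x| |]; case: (energy mu e0) => [y| |];
  case: (energy mu f) => [z| |] //=.
rewrite -?EFinM -?EFinD !lee_fin lte_fin exprVn => xz ye _ zm z0 _ _ _.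
have : 2 ^- m * z <= 2 ^- m * (z + 1) by rewrite ler_pM2l ?invr_gt0 ?exprn_gt0//; lra.
lra.
Qed.

(** Pi-lambda argument: the rays ]q, +oo[ generate the Borel sets and are stable under intersection.
    A complement amounts to subtracting from f, a disjoint union to a limit of finite sums. *)
Lemma csub_cutoff f (A : set Rm) : V f -> measurable A -> V (cutoff A f).
Proof.
move=> Vf mA; have mf := csub_cmeas cV Vf; have foo := csub_energy cV Vf.
have mE : @measurable _ Rm = <<s @RGenOInfty.G R >> by exact: RGenOInfty.measurableE.
apply: (@dynkin_induction _ Rm (@RGenOInfty.G R) (fun A => V (cutoff A f))).
- exact: mE.
- move=> _ _ [x ->] [y ->]; exists (Num.max x y).
  apply/seteqP; split => z /=; rewrite !in_itv/= !andbT gt_max.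
    by move=> [-> ->].
  by move=> /andP[].
- by move: Vf; congr V; apply/funext => x; rewrite cutoff_in.
- move=> _ [q ->].
  have mq : measurable (`]q, +oo[%classic : set Rm) by exact: measurable_itv.
  (* For q <= 0 the cutoff is f almost everywhere, and for q > r it is 0, the measure being carried
     by ]0, r[. *)
  have [q0|q0] := leP q 0.
    apply: (csub_ae cV Vf); first exact: cmeas_cutoff.
    apply: aeS (lambda_inside R r_gt0) => x /andP[x0 _] _.
    by rewrite cutoff_in//= in_itv/= andbT (le_lt_trans q0).
  have [qr|qr] := leP q r%:R; first exact: csub_cutoff_right.
  apply: (csub_ae cV (csub_0 cV)); first exact: cmeas_cutoff.
  apply: aeS (lambda_inside R r_gt0) => x /andP[_ xr] _.
  rewrite cutoff_out//= in_itv/= andbT; apply/negP.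
  by rewrite -leNgt ltW// (lt_trans xr).
- move=> S mS VS; have := csubB cV Vf VS; congr V; apply/funext => x.
  have [Sx|nSx] := pselect (S x).
    by rewrite cutoff_in// cutoff_out ?subrr//; apply.
  by rewrite (cutoff_out _ nSx) cutoff_in ?subr0.
- move=> F mF tF VF; pose U N : set Rm := \bigcup_(i in `I_N) F i.
  have mU N : measurable (U N) by apply: bigcup_measurable => i _; exact: mF.
  have mUF : measurable (\bigcup_k F k) by apply: bigcup_measurable => i _; exact: mF.
  have VU N : V (cutoff (U N) f).
    elim: N => [|N IH].
      have := csub_0 cV; congr V; apply/funext => x.
      by rewrite cutoff_out//; case.
    have := csubD cV IH (VF N); congr V; apply/funext => x.
    have [[i /= iN Fix]|nU] := pselect (U N x).
      rewrite cutoff_in; last by exists i.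
      rewrite cutoff_out ?addr0; last first.
        move=> FNx; have := tF i N I I; move=> /(_ (ex_intro _ x (conj Fix FNx))).
        by move=> iE; rewrite iE ltnn in iN.
      by rewrite cutoff_in//; exists i => //=; exact: ltnW.
    rewrite (cutoff_out _ nU) add0r.
    have [FNx|nFN] := pselect (F N x).
      by rewrite !cutoff_in//; exists N => /=.
    rewrite (cutoff_out _ nFN) cutoff_out// => -[i /=].
    rewrite ltnS leq_eqVlt => /predU1P[->//|iN Fix].
    by apply: nU; exists i.
  apply: (csub_cvg cV _ VU); first exact: cmeas_cutoff.
  rewrite (_ : (fun N => _) = (fun N => energy mu (cutoff (\bigcup_k F k `\` U N) f))).
    apply: energy_cutoff_cvg0 => //; first by move=> N; exact: measurableD.
    apply: aeW => x; have [[i _ Fix]|nF] := pselect ((\bigcup_k F k) x).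
      exists i.+1 => //= N /= iN [_]; apply; exists i => //.
    by exists 0%N => //= N _ [].
  apply/funext => N; congr energy; apply/funext => x.
  have [Ux|nUx] := pselect (U N x).
    have Fx : (\bigcup_k F k) x by case: Ux => i _ Fix; exists i.
    by rewrite (cutoff_in _ Fx) (cutoff_in _ Ux) cutoff_out ?subrr//; case.
  rewrite (cutoff_out _ nUx) subr0.
  have [Fx|nFx] := pselect ((\bigcup_k F k) x); first by rewrite !cutoff_in.
  by rewrite (cutoff_out _ nFx) cutoff_out//; case.
- by rewrite -mE.
Qed.

(** * From the constant 1 to all of L2 *)

Lemma cvg_sqr_sub (a : R) (s : nat -> R) : s k @[k --> \oo] --> a ->
  (a - s k) ^+ 2 @[k --> \oo] --> 0.
Proof.
move=> sa; have c0 : a - s k @[k --> \oo] --> 0.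
  by rewrite -(subrr a); apply: cvgB => //; exact: cvg_cst.
rewrite (_ : (fun k => _) = (fun k => a - s k) \* (fun k => a - s k)).
  have <- : (0 : R) * 0 = 0 by rewrite mulr0.
  by apply: cvgM.
by apply/funext => k; rewrite expr2.
Qed.

Import HBNNSimple.

Lemma csub_nnsfun (s : {nnsfun Rm >-> R}) : V (fun=> 1) -> V (fun x => (s x)%:C).
Proof.
move=> V1; rewrite (_ : (fun x => _) = (fun x =>
    \sum_(i < #|` fset_set (range s)|) ((fset_set (range s))`_i)%:C *
      cutoff (s @^-1` [set (fset_set (range s))`_i]) (fun=> 1) x)); last first.
  apply/funext => x; rewrite (fimfunEord s) rmorph_sum/=; apply: eq_bigr => i _.
  by rewrite rmorphM/= /cutoff mulr1.
(* The sum is lifted to functions so that closure of V under addition applies term by term. *)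
rewrite (_ : (fun x => _) = \sum_(i < #|` fset_set (range s)|)
    (fun x => ((fset_set (range s))`_i)%:C *
      cutoff (s @^-1` [set (fset_set (range s))`_i]) (fun=> 1) x)); last first.
  by apply/funext => x; rewrite fct_sumE.
elim/big_ind : _ => [|f1 f2 Vf1 Vf2|i _].
- exact: csub_0 cV.
- exact: (csubD cV Vf1 Vf2).
- by apply: (csubZ cV); apply: csub_cutoff => //; exact: measurable_funPTI.
Qed.

(** Simple functions 0 <= s_k <= u converge pointwise to u, and (u - s_k)^2 <= u^2 provides the
    domination. *)
Lemma csub_ge0 (u : Rm -> R) : V (fun=> 1) -> measurable_fun setT u ->
  (forall x, 0 <= u x) -> (energy mu (fun x => (u x)%:C) < +oo)%E ->
  V (fun x => (u x)%:C).
Proof.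
move=> V1 mu_ u0 uoo; have meu : measurable_fun setT (EFin \o u).
  exact/measurable_EFinP.
pose s := nnsfun_approx measurableT meu.
have su k x : s k x <= u x.
  rewrite /s nnsfun_approxE -lee_fin; apply: (le_approx (f := EFin \o u)) => //.
  by move=> y _; rewrite lee_fin.
have mcu : cmeas (fun x : Rm => (u x)%:C) by exact: cmeas_real.
have ms k : cmeas (fun x : Rm => (s k x)%:C) by apply: cmeas_real.
apply: (csub_cvg cV (g_ := fun k x => (s k x)%:C)) => //.
  by move=> k; exact: csub_nnsfun.
apply: (energy_dominated_cvg0 mcu) => //.
- by move=> k; exact: cmeasB.
- move=> k x; rewrite -rmorphB/= !sqcR lerXn2r ?nnegrE ?subr_ge0//.
  by rewrite gerBl.
- apply: aeW => x; have : s k x @[k --> \oo] --> u x.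
    have /fine_cvg : (s k x)%:E @[k --> \oo] --> (u x)%:E.
      apply: (@cvg_nnsfun_approx _ _ _ _ measurableT _ meu _ x I).
      by move=> y _; rewrite lee_fin.
    by [].
  move=> /cvg_sqr_sub; apply: cvg_trans; apply: near_eq_cvg; apply: nearW => k.
  by rewrite -rmorphB/= sqcR.
Qed.

(** The positive and negative parts of Re h and Im h are bounded by |h|, hence have finite energy; h
    is a combination of these four functions. *)
Lemma csub_full : V (fun=> 1) -> V = L2 mu.
Proof.
move=> V1; apply/seteqP; split=> [f|h /L2E[mh hoo]]; first exact: (csub_L2 cV).
have part (u : Rm -> R) : measurable_fun setT u ->
    (forall x, u x ^+ 2 <= sqc (h x)) -> V (fun x => (u x)%:C).
  move=> mu_ uh.
  have pos (w : Rm -> R) : measurable_fun setT w -> (forall x, w x ^+ 2 <= sqc (h x)) ->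
      V (fun x => (Num.max (w x) 0)%:C).
    move=> mw wh; apply: csub_ge0 => //.
    + by apply: measurable_maxr.
    + by move=> x; rewrite le_max lexx orbT.
    + apply: le_lt_trans hoo; apply: energy_le => //.
        by apply: cmeas_real; exact: measurable_maxr.
      move=> x; rewrite sqcR; have [w0|w0] := leP (w x) 0; last exact: wh.
      by rewrite expr0n sqc_ge0.
  have Vp := pos u mu_ uh.
  have Vn : V (fun x => (Num.max (- u x) 0)%:C).
    by apply: pos => [|x]; [exact: measurableT_comp|rewrite sqrrN].
  have := csubB cV Vp Vn; congr V; apply/funext => x.
  rewrite -rmorphB/=; congr (_%:C).
  by have [u0|u0] := leP (u x) 0; case: leP; lra.
have Vr : V (fun x => (complex.Re (h x))%:C).
  by apply: part => [|x]; [exact: mh.1|rewrite lerDl sqr_ge0].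
have Vi : V (fun x => (complex.Im (h x))%:C).
  by apply: part => [|x]; [exact: mh.2|rewrite lerDr sqr_ge0].
have := csub_linear cV 'i%C Vi Vr; congr V; apply/funext => x.
by rewrite addrC -complexE.
Qed.

(** * Zooming in at a Lebesgue point *)

Lemma energy_cutoff_le (J B : set Rm) (f : Rm -> R[i]) : cmeas f ->
  measurable J -> measurable B -> J `<=` B ->
  (energy mu (cutoff J f) <= \int[leb]_(x in B) (sqc (f x))%:E)%E.
Proof.
move=> mf mJ mB JB; have mI : measurable (`[0, r%:R]%classic : set Rm).
  exact: measurable_itv.
have mcf := cmeas_cutoff mf mJ.
rewrite energy_lambda//.
(* Since 1 / r <= 1, the normalised measure is at most Lebesgue measure. *)
apply: (@le_trans _ _ (\int[leb]_(x in `[0%R, r%:R]) (sqc (cutoff J f x))%:E)%E).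
  apply: gee_pMl.
  - by [].
  - by apply: integral_ge0 => x _; rewrite lee_fin sqc_ge0.
  - by rewrite lee_fin invf_le1// ltr0n.
rewrite integral_mkcond [leRHS]integral_mkcond; apply: ge0_le_integral => //.
- by move=> x _; rewrite patchE; case: ifP; rewrite ?lee_fin ?sqc_ge0.
- apply/(measurable_restrictT _ _).1 => //; apply: measurable_funTS.
  exact: measurable_sqcE.
- apply/(measurable_restrictT _ _).1 => //; apply: measurable_funTS.
  exact: measurable_sqcE.
- move=> x _; rewrite !patchE.
  have [Jx|nJx] := pselect (J x).
    rewrite (mem_set (JB _ Jx)) cutoff_in//.
    by case: ifP => //; rewrite lee_fin sqc_ge0.
  rewrite cutoff_out// sqc0 (_ : (if _ then _ else _) = 0%E); last by case: ifP.
  by case: ifP; rewrite ?lee_fin ?sqc_ge0.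
Qed.

(** With s = n^k, J = [t, t + p] and U the Koopman operator of the swap, take h = sqrt s U (1_J f).
    The swap expands J onto A = [t, t + s p], where its density is s^-1, so sqrt s U (1_J z) = 1_A
    z. The difference is thus - sqrt s U (1_J (f - z)), and U is isometric. *)
Lemma koopman_zoom f (z : R[i]) (t p : R) (k : int) : V f -> 0 <= t -> 0 <= p ->
  t + p + n%:R ^ k * p <= r%:R -> Zinv n t -> Zinv n p ->
  exists2 h, V h &
   (energy mu (fun x => cutoff `[t, (t + n%:R ^ k * p)%R] (fun=> z) x - h x)%R =
    (n%:R ^ k)%:E * energy mu (cutoff `[t, (t + p)%R] (fun x => f x - z)%R))%E.
Proof.
move=> Vf t0 p0 tpr zt zp; have mf := csub_cmeas cV Vf; have foo := csub_energy cV Vf.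
have [g gE Vg] := Vswap t0 p0 tpr zt zp.
move: tpr gE; have : 0 < n%:R ^ k :> R by rewrite exprz_gt0// ltr0n ltnW.
set s : R := n%:R ^ k => s0 tpr gE; have giE := ns_inv_swap p0 s0 gE.
have si0 : 0 < s^-1 by rewrite invr_gt0.
have sp0 : 0 <= s * p by rewrite mulr_ge0// ltW.
set A : set Rm := `[t, t + s * p]%classic; set J : set Rm := `[t, t + p]%classic.
have mA : measurable A by exact: measurable_itv.
have mJ : measurable J by exact: measurable_itv.
exists (fun x => (Num.sqrt s)%:C * koopman g (cutoff J f) x).
  by apply: (csubZ cV); apply: Vg; exact: csub_cutoff.
set F := cutoff J (fun x => f x - z).
have mfz : cmeas (fun x => f x - z) by apply: cmeasB => //; exact: cmeas_cst.
have mF : cmeas F by exact: cmeas_cutoff.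
have Foo : (energy mu F < +oo)%E.
  apply: (@le_lt_trans _ _ (energy mu (fun x => f x - z))).
    by apply: energy_le => // x; exact: sqc_cutoff_le.
  apply: (le_lt_trans (energyD_le mu mf (cmeas_cst _ (- z)))).
  rewrite energy_cst lte_add_pinfty// ltey_eq fin_numM//.
  by rewrite ge0_fin_numE ?energy_ge0.
have mKF : cmeas (koopman g F) by exact: cmeas_koopman.
have hA x : A x -> swap t (s * p) s^-1 x = s^-1 * x + (t - s^-1 * t).
  by rewrite /A/= in_itv/= => /andP[tx xt]; rewrite swap_fst//; ring.
have KJ : {ae mu, forall x, (Num.sqrt s)%:C * koopman g (cutoff J (fun=> z)) x =
    cutoff A (fun=> z) x}.
  apply: aeS (koopman_swap t0 p0 s0 tpr gE mA si0 hA (cutoff J (fun=> z))) => x Hx.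
  have [Ax|nAx] := pselect (A x).
    rewrite Hx// mulrA -rmorphM/= -sqrtrM ?ltW// mulfV ?gt_eqF// sqrtr1 mul1r.
    rewrite (cutoff_in _ Ax) cutoff_in//.
    move: Ax; rewrite /A /J/= !in_itv/= => /andP[tx xt].
    rewrite swap_fst// lerDl mulr_ge0 ?subr_ge0 ?(ltW si0)//=.
    by rewrite lerD2l mulrC ler_pdivrMr// mulrC lerBlDl.
  rewrite (cutoff_out _ nAx) /koopman giE cutoff_out ?mulr0// => Jx; apply: nAx.
  move: Jx; rewrite /A /J/= !in_itv/= => /andP[tx xt].
  have xE := swapVK t p0 s0 x.
  rewrite -xE swap_fst// lerDl mulr_ge0 ?subr_ge0 ?(ltW s0)//=.
  by rewrite lerD2l ler_pM2l// lerBlDl.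
rewrite (@ae_eq_energy _ _ _ _ _ (fun x => - (Num.sqrt s)%:C * koopman g F x)).
- rewrite energyZ// sqcN sqcR sqr_sqrtr ?ltW//.
  by rewrite energy_koopman.
- apply: cmeasB; first by apply: cmeas_cutoff => //; exact: cmeas_cst.
  by apply: cmeasZ; apply: cmeas_koopman; exact: cmeas_cutoff.
- exact: cmeasZ.
- apply: aeS KJ => x Kx _.
  transitivity ((Num.sqrt s)%:C * koopman g (cutoff J (fun=> z)) x -
      (Num.sqrt s)%:C * koopman g (cutoff J f) x).
    by congr (_ - _); exact: esym.
  have -> : cutoff J f = (fun x => F x + cutoff J (fun=> z) x).
    by apply/funext => y; rewrite /F /cutoff; ring.
  by rewrite koopmanD; ring.
Qed.

(** Apply [koopman_zoom] to intervals of length about n^-k near x0. Expansion multiplies the energy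
    of f - f x0 by n^k, which the Lebesgue point property, an o(rho) bound, compensates; the
    expanded intervals fill [x0, r]. *)
Lemma csub_lebesgue_pt f (x0 : R) : V f -> 0 < x0 -> x0 < r%:R ->
  (forall e, 0 < e -> \forall rho \near 0^'+,
    (\int[leb]_(y in ball x0 rho) (sqc (f y - f x0))%:E <= (e * rho)%:E)%E) ->
  V (cutoff `]x0, +oo[%classic (fun=> f x0)).
Proof.
move=> Vf x00 x0r Lf; set z := f x0.
have mf := csub_cmeas cV Vf; have foo := csub_energy cV Vf.
have mz := cmeas_cst Rm z.
have mU : measurable (`]x0, +oo[%classic : set Rm) by exact: measurable_itv.
have r0 : 0 < r%:R :> R by rewrite ltr0n.
apply: (csub_lim cV) => [|e e0]; first exact: cmeas_cutoff.
pose s k : R := n%:R ^- k.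
have s0 k : 0 < s k by exact: expNn_gt0.
have s1 k : s k <= 1 by exact: expNn_le1.
(* x0 need not be n-adic: it is rounded down to the grid of step n^-2k. *)
pose t k : R := (Num.floor (x0 / s k ^+ 2))%:~R * s k ^+ 2.
have s20 k : 0 < s k ^+ 2 by rewrite exprn_gt0.
have t_le k : t k <= x0 by rewrite -ler_pdivlMr//; exact: floor_le.
have t_gt k : x0 < t k + s k ^+ 2.
  rewrite /t -[X in _ + X]mul1r -mulrDl -ltr_pdivrMr// -[1]/(1%:~R) -intrD.
  exact: floorD1_gt.
have t0 k : 0 <= t k.
  apply: mulr_ge0; last exact: ltW.
  by rewrite ler0z floor_ge0; apply: divr_ge0; exact: ltW.
have zs k : Zinv n (s k) by exact: Zinv_expNn.
have zt k : Zinv n (t k).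
  by rewrite /t expr2; apply: ZinvM; [exact: Zinv_int|exact: ZinvM].
(* Chosen so that the expanded interval has length (r - t)(1 - s) and the swap ends at t + (r - t)(1
   - s^2), just below r. *)
pose p k : R := (r%:R - t k) * s k * (1 - s k).
have zp k : Zinv n (p k).
  apply: ZinvM; last by apply: ZinvB => //; exact: (Zinv_int R n 1).
  by apply: ZinvM => //; apply: ZinvB => //; exact: Zinv_nat.
have rt k : 0 < r%:R - t k by rewrite subr_gt0 (le_lt_trans (t_le k)).
have p0 k : 0 <= p k by rewrite !mulr_ge0 ?subr_ge0// ltW// -subr_gt0.
have spE k : n%:R ^ k%:Z * p k = (r%:R - t k) * (1 - s k).
  have nk : n%:R ^+ k != 0 :> R by rewrite expf_neq0// pnatr_eq0 -lt0n ltnW.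
  by rewrite -exprnP /p /s; field.
have tpr k : t k + p k + n%:R ^ k%:Z * p k <= r%:R.
  rewrite spE /p -subr_ge0.
  rewrite (_ : _ - _ = (r%:R - t k) * s k ^+ 2); last by ring.
  by rewrite mulr_ge0// ltW.
pose A k : set Rm := `[t k, t k + n%:R ^ k%:Z * p k]%classic.
have mA k : measurable (A k) by exact: measurable_itv.
(* The interval [t, t + p] lies in the ball of radius 2 r s, so after expansion by s^-1 the error is
   at most 2 r eta = e / 8. The other error is below e / 4, and 2 (e / 4) + 2 (e / 8) < e. *)
pose eta := e / (16 * r%:R).
have eta0 : 0 < eta by rewrite divr_gt0// mulr_gt0.
have [d /= d0 Hd] := Lf _ eta0.
have dr0 : 0 < d / (2 * r%:R) by rewrite divr_gt0// mulr_gt0.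
have cvgA : energy mu (fun x => cutoff `]x0, +oo[%classic (fun=> z) x -
    cutoff (A k) (fun=> z) x) @[k --> \oo] --> 0%E.
  apply: (energy_dominated_cvg0 mz).
  - by move=> k; apply: cmeasB; exact: cmeas_cutoff.
  - by rewrite energy_cst ltry.
  - move=> k x; rewrite /cutoff !indicE.
    by do 2!case: (_ \in _); rewrite ?mul1r ?mul0r ?subrr ?subr0 ?sub0r ?sqcN ?sqc0 ?sqc_ge0.
  (* For x in ]0, r[ other than x0, membership in [A k] eventually coincides with x0 < x. *)
  - apply: aeS2 (lambda_inside R r_gt0) (lambda_neq r_gt0 x0) => x /andP[xgt0 xr] xx0.
    have sqcB0 (a b : R[i]) : a = b -> sqc (a - b) = 0 by move=> ->; rewrite subrr sqc0.
    apply: cvg_near_cst.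
    have dx0 : 0 < `|x - x0| by rewrite normr_gt0 subr_eq0.
    have dr : 0 < (r%:R - x) / r%:R by rewrite divr_gt0// subr_gt0.
    apply: filterS2 (near_expNn_lt n_gt1 dx0) (near_expNn_lt n_gt1 dr) => k.
    rewrite -/(s k) => sx; rewrite ltr_pdivlMr// => sr.
    have ss : s k ^+ 2 <= s k by rewrite expr2 ler_piMl// ltW.
    have := t_le k; have := t_gt k; move=> tg tl.
    have [xlt|xge] := ltP x x0.
      rewrite ltr0_norm ?subr_lt0// in sx.
      have nA : ~ A k x by rewrite /A/= in_itv/= => /andP[]; lra.
      have nU : ~ (`]x0, +oo[%classic : set Rm) x.
        by rewrite /= in_itv/= andbT; apply/negP; rewrite -leNgt ltW.
      by apply: sqcB0; transitivity (0 : R[i]);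
        [exact: cutoff_out|exact/esym/cutoff_out].
    have {}xge : x0 < x by rewrite lt_neqAle eq_sym xx0.
    have Ax : A k x.
      rewrite /A/= in_itv/= spE; have st : 0 <= s k * t k by rewrite mulr_ge0// ltW.
      by apply/andP; split; lra.
    have Ux : (`]x0, +oo[%classic : set Rm) x by rewrite /= in_itv/= xge.
    by apply: sqcB0; transitivity z; [exact: cutoff_in|exact/esym/cutoff_in].
have e4 : 0 < e / 4 by rewrite divr_gt0.
have [k _ /(_ k (leqnn k)) /= [Ak sk]] :=
  filterI (cvge0_lt cvgA e4) (near_expNn_lt n_gt1 dr0).
rewrite -/(s k) ltr_pdivlMr ?mulr_gt0// in sk.
have [h Vh hE] := koopman_zoom z Vf (t0 k) (p0 k) (tpr k) (zt k) (zp k).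
have mh := csub_cmeas cV Vh.
exists h => //.
rewrite (_ : (fun x => _) = (fun x => (cutoff `]x0, +oo[%classic (fun=> z) x -
    cutoff (A k) (fun=> z) x) + (cutoff (A k) (fun=> z) x - h x))); last first.
  by apply/funext => x; ring.
have m1 : cmeas (fun x : Rm => cutoff `]x0, +oo[%classic (fun=> z) x -
    cutoff (A k) (fun=> z) x).
  by apply: cmeasB; exact: cmeas_cutoff.
have m2 : cmeas (fun x : Rm => cutoff (A k) (fun=> z) x - h x).
  by apply: cmeasB => //; exact: cmeas_cutoff.
apply: (le_lt_trans (energyD_le mu m1 m2)).
have rho0 : 0 < s k * (2 * r%:R) by rewrite !mulr_gt0.
have E2 : (energy mu (fun x => cutoff (A k) (fun=> z) x - h x)%R <= (e / 8)%:E)%E.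
  rewrite hE; apply: (@le_trans _ _ ((n%:R ^ k%:Z)%:E * (eta * (s k * (2 * r%:R)))%:E)%E).
    apply: lee_wpmul2l; first by rewrite lee_fin exprz_ge0.
    apply: le_trans (Hd _ _ rho0); last by rewrite /ball_/= sub0r normrN gtr0_norm.
    apply: energy_cutoff_le.
    - by apply: cmeasB.
    - exact: measurable_itv.
    - exact: measurable_ball.
    - move=> x /=; rewrite in_itv/= => /andP[tx xt].
      rewrite /ball/= distrC ltr_distl.
      have pr : p k <= s k * r%:R.
        rewrite /p mulrAC mulrC ler_pM2l//.
        apply: (@le_trans _ _ (r%:R - t k)); last by rewrite gerBl.
        by rewrite ler_piMr ?ltW// gtrBl.
      have sr : s k ^+ 2 <= s k * r%:R.
        by rewrite expr2 ler_pM2l// (le_trans (s1 k)).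
      have := t_le k; have := t_gt k; have : 0 < s k * r%:R by rewrite mulr_gt0.
      by move=> *; apply/andP; split; lra.
  rewrite -EFinM lee_fin -exprnP /eta /s le_eqVlt; apply/orP; left; apply/eqP.
  have rn0 : r%:R != 0 :> R by rewrite gt_eqF.
  have n0 : n%:R != 0 :> R by rewrite pnatr_eq0 -lt0n ltnW.
  by field; rewrite ?rn0 ?expf_neq0.
move: Ak E2; have := energy_ge0 mu (fun x => cutoff (A k) (fun=> z) x - h x).
have := energy_ge0 mu (fun x => cutoff `]x0, +oo[%classic (fun=> z) x -
  cutoff (A k) (fun=> z) x).
case: (energy _ _) => [u| |]//; case: (energy _ _) => [v| |]//.
rewrite -?EFinM -?EFinD !lee_fin !lte_fin; lra.
Qed.

(** A swap at 0 with slope s = n^-k and p = r (1 - s) expands the short interval [J k] near r onto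
    [A k]. Once p > x0 the indicator of [J k] is a cutoff of the given element of V, and [A k] fills
    ]0, r[ as k grows. *)
Lemma csub_one (x0 : R) : x0 < r%:R ->
  V (cutoff `]x0, +oo[%classic (fun=> 1)) -> V (fun=> 1).
Proof.
move=> x0r VU; have r0 : 0 < r%:R :> R by rewrite ltr0n.
have m1 := cmeas_cst Rm (1 : R[i]).
pose s k : R := n%:R ^- k.
have s0 k : 0 < s k by exact: expNn_gt0.
have s1 k : s k <= 1 by exact: expNn_le1.
pose p k : R := r%:R * (1 - s k).
have p0 k : 0 <= p k by rewrite mulr_ge0 ?subr_ge0// ltW.
have sp0 k : 0 <= s k * p k by rewrite mulr_ge0// ltW.
have ssr k : s k * p k <= s k * r%:R.
  by rewrite ler_pM2l// /p ler_piMr ?ltW// gtrBl.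
have spr k : 0 + p k + s k * p k <= r%:R.
  rewrite -subr_ge0 (_ : _ - _ = r%:R * s k ^+ 2); last by rewrite /p; ring.
  by rewrite mulr_ge0 ?exprn_ge0// ltW.
pose A k : set Rm := `[s k * p k, s k * p k + p k]%classic.
pose J k : set Rm := `[p k, p k + s k * p k]%classic.
have mA k : measurable (A k) by exact: measurable_itv.
have mJ k : measurable (J k) by exact: measurable_itv.
have VA k : x0 < p k -> V (cutoff (A k) (fun=> 1)).
  move=> x0p; have sE : n%:R ^ (- k%:Z) = s k by rewrite /s exprnN.
  have zs : Zinv n (s k) by exact: Zinv_expNn.
  have zp : Zinv n (p k).
    apply: ZinvM; first exact: Zinv_nat.
    by apply: ZinvB => //; exact: (Zinv_int R n 1).
  have := @Vswap 0 (p k) (- k%:Z); rewrite sE.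
  move=> /(_ (lexx _) (p0 k) (spr k) (Zinv_int R n 0) zp)[g gE Vg].
  have giE := ns_inv_swap (p0 k) (s0 k) gE.
  have si0 : 0 < (s k)^-1 by rewrite invr_gt0.
  have sK : (s k)^-1 * (s k * p k) = p k by rewrite mulKf// gt_eqF.
  have hA x : A k x -> swap 0 (s k * p k) (s k)^-1 x =
      s k * x + (p k - s k * (s k * p k)).
    rewrite /A/= in_itv/= => /andP[xs xp].
    by rewrite (swap_snd (sp0 k) si0) ?sK ?add0r// invrK; ring.
  have VJ : V (cutoff (J k) (fun=> 1)).
    have := csub_cutoff VU (mJ k); congr V; apply/funext => x.
    have [Jx|nJx] := pselect (J k x); last by rewrite !(cutoff_out _ nJx).
    rewrite !(cutoff_in _ Jx); apply: cutoff_in.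
    by move: Jx; rewrite /J/= !in_itv/= andbT => /andP[+ _]; exact: lt_le_trans.
  (* The density is s on [A k]; dividing by its square root turns the image of 1_J into 1_A. *)
  have := csubZ cV ((Num.sqrt (s k))^-1)%:C (Vg _ VJ).
  move=> /(csub_ae cV); apply; first exact: cmeas_cutoff.
  apply: aeS (koopman_swap (lexx 0) (p0 k) (s0 k) (spr k) gE (mA k) (s0 k) hA
    (cutoff (J k) (fun=> 1))) => x Hx _.
  have [Ax|nAx] := pselect (A k x).
    rewrite (cutoff_in _ Ax) Hx// cutoff_in.
      rewrite mulr1 -rmorphM/= mulVf// gt_eqF// sqrtr_gt0//.
    rewrite hA//; move: Ax; rewrite /A /J/= !in_itv/= => /andP[xs xp].
    have : s k * (s k * p k) <= s k * x by rewrite ler_pM2l.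
    have : s k * x <= s k * (s k * p k + p k) by rewrite ler_pM2l.
    by move=> *; apply/andP; split; lra.
  rewrite (cutoff_out _ nAx) /koopman giE cutoff_out ?mulr0// => Jx; apply: nAx.
  have xE := swapVK 0 (p0 k) (s0 k) x.
  move: Jx xE; rewrite /A /J/= !in_itv/= => /andP[y1 y2].
  rewrite swap_snd ?add0r// subr0 => <-.
  rewrite lerDl lerD2l divr_ge0 ?subr_ge0 ?(ltW (s0 k))//=.
  by rewrite ler_pdivrMr// lerBlDl [p k * s k]mulrC.
apply: (csub_lim cV) => // e e0.
have cvgA : energy mu (cutoff (~` A k) (fun=> 1)) @[k --> \oo] --> 0%E.
  apply: energy_cutoff_cvg0 => //.
  - by rewrite energy_cst ltry.
  - by move=> k; exact: measurableC.
  - apply: aeS (lambda_inside R r_gt0) => x /andP[xgt0 xr].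
    have d1 : 0 < x / r%:R by rewrite divr_gt0.
    have d2 : 0 < (r%:R - x) / r%:R by rewrite divr_gt0// subr_gt0.
    apply: filterS2 (near_expNn_lt n_gt1 d1) (near_expNn_lt n_gt1 d2) => k.
    rewrite -/(s k) !ltr_pdivlMr// => k1 k2; apply; rewrite /A/= in_itv/=.
    have sx := ssr k; have sp := sp0 k.
    by apply/andP; split; rewrite /p in sx sp *; lra.
have d0 : 0 < (r%:R - x0) / r%:R by rewrite divr_gt0// subr_gt0.
have [k _ /(_ k (leqnn k)) /= [Ak sk]] :=
  filterI (cvge0_lt cvgA e0) (near_expNn_lt n_gt1 d0).
exists (cutoff (A k) (fun=> 1)).
  by apply: VA; rewrite -/(s k) ltr_pdivlMr// in sk; rewrite /p; lra.
suff -> : (fun x : Rm => (1 : R[i]) - cutoff (A k) (fun=> 1) x) =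
    cutoff (~` A k) (fun=> 1).
  exact: Ak.
apply/funext => x; have [Ax|nAx] := pselect (A k x).
  by rewrite (cutoff_in _ Ax) cutoff_out ?subrr//; apply.
by rewrite (cutoff_out _ nAx) cutoff_in ?subr0.
Qed.

(** A nonzero class is nonzero at some Lebesgue point inside ]0, r[, where zooming produces a
    nonzero multiple of the indicator of ]x0, +oo[, hence 1, hence everything. *)
Lemma csub_dichotomy :
  V = [set f | L2 mu f /\ f = (fun=> 0) %[ae mu]] \/ V = L2 mu.
Proof.
have [V0|] := pselect (forall f, V f -> f = (fun=> 0) %[ae mu]).
  left; apply/seteqP; split=> [f Vf|f [/L2E[mf _] f0]].
    by split; [exact: (csub_L2 cV)|exact: V0].
  exact: (csub_ae cV (csub_0 cV)).
move=> /existsNP[f0 /not_implyP[Vf0 f0N]]; right.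
have mI : measurable (`[0, r%:R]%classic : set Rm) by exact: measurable_itv.
(* Vanishing outside [0, r] makes f suitable for Lebesgue differentiation on the whole line. *)
pose f := cutoff (`[0, r%:R]%classic : set Rm) f0.
have Vf : V f by exact: csub_cutoff.
have mf := csub_cmeas cV Vf; have foo := csub_energy cV Vf.
have fI x : ~ (`[0, r%:R]%classic : set Rm) x -> f x = 0 by exact: cutoff_out.
have Lf := L2_lebesgue_pt mf foo fI.
suff [x0 [x00 x0r Lx0 fx0]] : exists x0 : R, [/\ 0 < x0, x0 < r%:R,
    (forall e : R, 0 < e -> \forall rho \near 0^'+,
    (\int[leb]_(y in ball x0 rho) (sqc (f y - f x0))%:E <= (e * rho)%:E)%E) & f x0 != 0].
  have VU := csub_lebesgue_pt Vf x00 x0r Lx0.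
  apply: csub_full; apply: (csub_one x0r).
  have := csubZ cV (f x0)^-1 VU; congr V; apply/funext => x.
  by rewrite /cutoff mulr1 mulrCA mulVf// mulr1.
(* If f vanished at every such point, then f0 would be 0 almost everywhere. *)
apply: contra_notP f0N => H.
apply: aeS2 (lambda_inside R r_gt0) (lambda_ae_le r_gt0 Lf) => x /andP[xgt0 xr] Lx _.
have <- : f x = f0 x by apply: cutoff_in; rewrite /= in_itv/= !ltW.
by apply: contra_notP H => /eqP fx; exists x.
Qed.

End irreducibility.

Theorem theorem1 (R : realType) (n r : nat) (n_gt1 : (1 < n)%N)
    (r_gt0 : (0 < r)%N) :
  @koopman_irreducible _ _ R (lambda R r_gt0) (@thompson_F R n r r_gt0) /\
  @koopman_irreducible _ _ R (lambda R r_gt0) (@thompson_G R n r r_gt0).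
Proof.
(* For either group, each admissible swap is realised by a nonsingular transformation in the group,
   so invariance of V supplies [Vswap]. *)
split=> V cV inv; apply: (csub_dichotomy n_gt1 cV) => a p k a0 p0 pr za zp.
- have [g gF gE] := thompson_F_nonsingular r_gt0 (swap_in_F n_gt1 a0 p0 pr za zp).
  by exists g => // f Vf; exact: (inv g gF).
- have [g gG gE] := thompson_G_nonsingular r_gt0 (swap_in_G n_gt1 a0 p0 pr za zp).
  by exists g => // f Vf; exact: (inv g gG).
Qed.
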